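(* Let $n\ge2$, let $z\in B_n$ have symmetric normal form $(t_1,\dots,t_q;s_1,\dots,s_p)$, and let $u$ be a simple $n$-braid. (i) Put $u_p:=u$ and, for $i=p,p-1,\dots,1$, let $u_{i-1},s'_i$ be the simple braids determined by $$s_i\,u_i=u_{i-1}\,s'_i\quad\text{and}\quad(u_{i-1},s'_i)\ \text{is normal}.$$ Next, let $v_0,v_1$ be the simple braids determined by ${}^*u_0\,t_1=v_0v_1$ with $(v_0,v_1)$ normal, and, for $j=2,\dots,q$, let $t'_j,v_j$ be the simple braids determined by $$v_{j-1}\,t_j=t'_j\,v_j\quad\text{and}\quad(t'_j,v_j)\ \text{is normal}$$ (if $q=0$, one replaces the empty sequence $(t_1,\dots,t_q)$ by the sequence of length $q=1$ with $t_1=1$). Then the symmetric normal form of $zu$ is $(t'_2,\dots,t'_q,v_q;\,v_0^*,s'_1,\dots,s'_p)$, up to deleting the trailing entries equal to $1$ in each of the two sequences. (ii) Put $u_p:=u$ and, for $i=p,p-1,\dots,1$, let $u_{i-1},s'_i$ be the simple braids determined by $$s'_i\,u_i=u_{i-1}\,s_i\quad\text{and}\quad\gcd\nolimits_L(s'_i,u_{i-1})=1 .$$ Next, put $v_0:=u_0$ and, for $j=1,\dots,q$, let $t'_j,v_j$ be the simple braids determined by $$v_{j-1}\,t_j=t'_j\,v_j\quad\text{and}\quad(t'_j,v_j)\ \text{is normal}.$$ Then the symmetric normal form of $zu^{-1}$ is $(t'_1,\dots,t'_q,v_q;\,s'_1,\dots,s'_p)$, up to deleting the trailing entries equal to $1$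 in each of the two sequences.
   Context: $B_n$ is Artin's braid group with generators $\sigma_1,\dots,\sigma_{n-1}$ and relations $\sigma_i\sigma_j=\sigma_j\sigma_i$ for $|i-j|\ge2$, $\sigma_i\sigma_j\sigma_i=\sigma_j\sigma_i\sigma_j$ for $|i-j|=1$; $B_n^+$ is the submonoid generated by $\sigma_1,\dots,\sigma_{n-1}$ (positive braids). For $x,y\in B_n^+$, $x$ is a left (resp. right) divisor of $y$ if $y=xz$ (resp. $y=zx$) for some $z\in B_n^+$. Any two $x,y\in B_n^+$ have a greatest common left divisor $\gcd_L(x,y)$ and a least common left multiple $\mathrm{lcm}_L(x,y)$. $\Delta_n\in B_n^+$ is defined by $\Delta_1=1$, $\Delta_n=\sigma_1\sigma_2\cdots\sigma_{n-1}\Delta_{n-1}$. Simple braids are the left divisors of $\Delta_n$ in $B_n^+$ (which coincide with its right divisors). For $s$ simple, $s^*$ and ${}^*s$ are the unique (simple) braids with $s\,s^*=\Delta_n$ and ${}^*s\,s=\Delta_n$. A sequence $(s_1,\dots,s_p)$ of simple braids is normal if, for each $k<p$, every $\sigma_i$ that is a left divisor of $s_{k+1}$ is a right divisor of $s_k$. Every $z\in B_n$ has a unique decomposition $z=t_q^{-1}\cdots t_1^{-1}s_1\cdots s_p$ with $p,q\ge0$ and $(s_1,\dots,s_p)$, $(t_1,\dots,t_q)$ two normal sequences of simple braids with $s_p\ne1$, $t_q\ne1$ and $\gcd_L(s_1,t_1)=1$ (a condition involving an entry of an empty sequence being void); $(t_1,\dots,t_q;s_1,\dots,s_p)$ is called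 the symmetric normal form of $z$. The pairs in (i) and (ii) exist and are unique: every product of two simple braids can be written uniquely as $ab$ with $(a,b)$ a normal pair of simple braids; and for simple $s,t$ the unique simple $s',t'$ with $s't=t's$ and $\gcd_L(s',t')=1$ are those with $s't=t's=\mathrm{lcm}_L(s,t)$. *)

(* Defs.v *)
From HB Require Import structures.
From mathcomp Require Import all_boot.
From mathcomp Require Import boolp classical_sets.

Set Implicit Arguments.
Unset Strict Implicit.
Unset Printing Implicit Defensive.

Local Open Scope group_scope.
Local Open Scope quotient_scope.

(* Artin's presentation.  The ordinal i : 'I_n.-1 stands for the generator    *)
(* sigma_(i+1); the letter (i, false) is this generator and (i, true) is its  *)
(* inverse.                                                                   *)
Definition braid_word (n : nat) := seq ('I_n.-1 * bool).

Inductive braid_eq (n : nat) : braid_word n -> braid_word n -> Prop :=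
| braid_eq_refl w : braid_eq w w
| braid_eq_sym v w : braid_eq v w -> braid_eq w v
| braid_eq_trans v w x : braid_eq v w -> braid_eq w x -> braid_eq v x
| braid_eq_cat v v' w w' :
    braid_eq v v' -> braid_eq w w' -> braid_eq (v ++ w) (v' ++ w')
| braid_eq_free i e : braid_eq [:: (i, e); (i, ~~ e)] [::]
| braid_eq_far (i j : 'I_n.-1) : (i.+1 < j)%N || (j.+1 < i)%N ->
    braid_eq [:: (i, false); (j, false)] [:: (j, false); (i, false)]
| braid_eq_near (i j : 'I_n.-1) : (i.+1 == j) || (j.+1 == i) ->
    braid_eq [:: (i, false); (j, false); (i, false)]
             [:: (j, false); (i, false); (j, false)].

Definition braid_eqb (n : nat) : rel (braid_word n) :=
  fun v w => `[< braid_eq v w >].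

Lemma braid_eqb_refl n : reflexive (@braid_eqb n).
Proof. by move=> w; apply/asboolP; exact: braid_eq_refl. Qed.

Lemma braid_eqb_sym n : symmetric (@braid_eqb n).
Proof. by move=> v w; apply/asboolP/asboolP => /braid_eq_sym. Qed.

Lemma braid_eqb_trans n : transitive (@braid_eqb n).
Proof.
by move=> v u w /asboolP uv /asboolP vw; apply/asboolP; exact: braid_eq_trans vw.
Qed.

Canonical braid_equiv n := EquivRel (@braid_eqb n)
  (@braid_eqb_refl n) (@braid_eqb_sym n) (@braid_eqb_trans n).

Definition braid (n : nat) := {eq_quot (braid_equiv n)}.
HB.instance Definition _ n := Choice.on (braid n).
HB.instance Definition _ n := EqQuotient.on (braid n).

Section BraidGroup.
Variable n : nat.
Implicit Types (v w : braid_word n) (x y : braid n).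

Definition braid_of_word w : braid n := \pi_(braid n) w.
Definition braid_inv_word w : braid_word n := rev [seq (l.1, ~~ l.2) | l <- w].

Definition braid_one : braid n := braid_of_word [::].
Definition braid_mul x y : braid n := braid_of_word (repr x ++ repr y).
Definition braid_inv x : braid n := braid_of_word (braid_inv_word (repr x)).

Lemma braid_of_wordP v w :
  braid_eq v w <-> braid_of_word v = braid_of_word w.
Proof.
split=> [vw | /eqmodP /asboolP //]; apply/eqmodP; exact/asboolP.
Qed.

Lemma braid_reprK x : braid_of_word (repr x) = x.
Proof. exact: reprK. Qed.

Lemma braid_mulE v w :
  braid_mul (braid_of_word v) (braid_of_word w) = braid_of_word (v ++ w).
Proof. by apply/braid_of_wordP/braid_eq_cat; apply/braid_of_wordP/braid_reprK. Qed.

Lemma braid_mulA : associative braid_mul.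
Proof.
move=> x y z; rewrite -[x]braid_reprK -[y]braid_reprK -[z]braid_reprK.
by rewrite !braid_mulE catA.
Qed.

Lemma braid_mul1 : left_id braid_one braid_mul.
Proof. by move=> x; rewrite -[x]braid_reprK braid_mulE. Qed.

Lemma braid_mulr1 : right_id braid_one braid_mul.
Proof. by move=> x; rewrite -[x]braid_reprK braid_mulE cats0. Qed.

Lemma braid_eq_wordV w : braid_eq (w ++ braid_inv_word w) [::].
Proof.
elim: w => [|[i e] w IHw]; first exact: braid_eq_refl.
rewrite /braid_inv_word map_cons rev_cons -cats1 cat_cons catA -cat1s.
apply: braid_eq_trans (braid_eq_free i e).
rewrite -[[:: _; _]]/([:: (i, e)] ++ ([::] ++ [:: (i, ~~ e)])).
by do ![exact: braid_eq_refl | exact: IHw | apply: braid_eq_cat].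
Qed.

Lemma braid_inv_wordK : involutive braid_inv_word.
Proof.
move=> w; rewrite /braid_inv_word map_rev revK -map_comp map_id_in //.
by move=> [i e] _ /=; rewrite negbK.
Qed.

Lemma braid_mulxV : right_inverse braid_one braid_inv braid_mul.
Proof.
move=> x; rewrite -{1}[x]braid_reprK braid_mulE.
exact/braid_of_wordP/braid_eq_wordV.
Qed.

Lemma braid_mulVx : left_inverse braid_one braid_inv braid_mul.
Proof.
move=> x; rewrite -{2}[x]braid_reprK braid_mulE; apply/braid_of_wordP.
by rewrite -{2}[repr x]braid_inv_wordK; exact: braid_eq_wordV.
Qed.

End BraidGroup.

HB.instance Definition _ n := isGroup.Build (braid n)
  (@braid_mulA n) (@braid_mul1 n) (@braid_mulr1 n)
  (@braid_mulVx n) (@braid_mulxV n).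

Section Garside.
Variable n : nat.
Implicit Types (i : 'I_n.-1) (x y z d s t u : braid n) (r : seq (braid n)).

Definition sigma i : braid n := braid_of_word [:: (i, false)].

Definition positive x : Prop :=
  exists w : seq 'I_n.-1, x = \big[*%g/1]_(i <- w) sigma i.

Definition left_divisor x y : Prop :=
  [/\ positive x, positive y & exists2 z, positive z & y = x * z].

Definition right_divisor x y : Prop :=
  [/\ positive x, positive y & exists2 z, positive z & y = z * x].

Definition is_gcdL x y d : Prop :=
  [/\ left_divisor d x, left_divisor d y &
      forall e : braid n, left_divisor e x -> left_divisor e y ->
        left_divisor e d].

(* Delta_k viewed inside B_n: the factor sigma_1 ... sigma_(k-1) is the       *)
(* product of the first k - 1 generators.  Only k >= 1 is meaningful.         *)
Fixpoint Delta_upto (k : nat) : braid n :=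
  if k is k'.+1 then
    (\big[*%g/1]_(i < n.-1 | (i < k')%N) sigma i) * Delta_upto k'
  else 1.

Definition Delta : braid n := Delta_upto n.

Definition simple s : Prop := left_divisor s Delta.

(* s^* and *s: in the group, the only solutions of s * x = Delta and          *)
(* x * s = Delta.                                                             *)
Definition rstar s : braid n := s^-1 * Delta.
Definition lstar s : braid n := Delta * s^-1.

Definition normal r : Prop :=
  (forall s, s \in r -> simple s) /\
  (forall k : nat, (k.+1 < size r)%N -> forall i,
     left_divisor (sigma i) (nth 1 r k.+1) ->
     right_divisor (sigma i) (nth 1 r k)).

(* The sequence t is listed as t_1, ..., t_q, hence rev.                      *)
Definition symmetric_normal_form z (t s : seq (braid n)) : Prop :=
  [/\ z = (\big[*%g/1]_(x <- rev t) x^-1) * (\big[*%g/1]_(x <- s) x),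
      normal t,
      normal s,
      (s <> [::] -> last 1 s <> 1) /\ (t <> [::] -> last 1 t <> 1) &
      (s <> [::] -> t <> [::] -> is_gcdL (head 1 s) (head 1 t) 1)].

(* xget returns an element of the given set when there is one.                *)
Definition normal_pair x : braid n * braid n :=
  xget (1, 1) [set ab : braid n * braid n |
    [/\ simple ab.1, simple ab.2, x = ab.1 * ab.2 & normal [:: ab.1; ab.2]]].

(* The pair (s', t') with s' t = t' s and gcd_L(s', t') = 1.                  *)
Definition coprime_pair s t : braid n * braid n :=
  xget (1, 1) [set ab : braid n * braid n |
    [/\ simple ab.1, simple ab.2, ab.1 * t = ab.2 * s & is_gcdL ab.1 ab.2 1]].

Definition trim r : seq (braid n) :=
  rev (drop (find (predC1 1) (rev r)) (rev r)).

End Garside.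

(* Main.v *)
From HB Require Import structures.
From mathcomp Require Import all_boot fingroup perm zify.
From mathcomp Require Import boolp classical_sets.
Require Import Defs.

Set Implicit Arguments.
Unset Strict Implicit.
Unset Printing Implicit Defensive.

Local Open Scope group_scope.
Local Open Scope quotient_scope.

(** Why the theorem holds.  Extend left divisibility to the whole group by
    x <=L y iff x^-1 * y is positive; this is a left-invariant order.  All the
    Garside theory that is needed is contained in [simple_gcd]: among the
    simple common left divisors of two positive braids there is a greatest one.

    Consequences.  A pair (a, b) of simple braids is normal iff rstar a and b
    have no common left divisor but 1 ([normal_cons]), and then a simple left
    divisor of u * a * b, with u simple, already divides u * a
    ([greedy_dvl_mull]).  This property gives the two domino rules [dominoL]
    and [dominoR]: in a row of commutative squares of simple braids, one side
    is normal as soon as the opposite side is.  It applies both to the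
    denominators t_j, whose squares v_(j-1) t_j = t'_j v_j are normal, and to
    the numerators s_i, whose squares u_(i-1) s_i = s'_i u_i have coprime
    (s'_i, u_(i-1)).  So dividing z by a simple braid u on the right, which
    means moving u^-1 to the left through the numerators and then multiplying
    the denominators by the result, keeps both sequences normal; the two first
    entries remain coprime by [coprimeL_cross].  This is [quotient_pass], and
    part (ii) is an instance of it.

    Part (i) is another instance.  As (lstar u)^-1 * Delta = u, multiplying by
    u is dividing by lstar u and then multiplying by Delta.  Up to
    conjugating the s'_i by Delta, the squares s_i u_i = u_(i-1) s'_i of part
    (i) are the squares of part (ii) for lstar u, and the final Delta turns the
    first denominator v_0 into the numerator v_0^*.

    The proof of [simple_gcd] goes through the symmetric group.  Simple braids
    correspond to permutations (Matsumoto's theorem, [matsumoto]), with the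
    weak order as left divisibility, and the weak order has meets ([ex_meet]).
    Hence the greatest simple left divisor of a positive word, its head, can be
    computed letter by letter as a permutation ([head_perm]), together with the
    cofactor ([head_tail]); both depend only on the positive braid.  The
    cofactor inverts the multiplication by Delta, and this cancellation
    property embeds the positive monoid in the braid group ([br_inj]): since
    Delta ^+ 2 is central, braids are fractions with denominators powers of
    Delta ^+ 2. *)

(** * Length and weak order in the symmetric group *)
Section Length.
Variable m : nat.
Implicit Types (i j : 'I_m) (x y z a b c e v : 'S_m.+1) (w : seq 'I_m).

Definition lo i : 'I_m.+1 := widen_ord (leqnSn m) i.
Definition hi i : 'I_m.+1 := lift ord0 i.
Definition adj i : 'S_m.+1 := tperm (lo i) (hi i).

Lemma adjK i : adj i * adj i = 1. Proof. exact: tperm2. Qed.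
Lemma adjV i : (adj i)^-1 = adj i. Proof. exact: tpermV. Qed.

Lemma adj_val i (k : 'I_m.+1) :
  adj i k = (if k == i :> nat then i.+1 else
             if k == i.+1 :> nat then i : nat else k) :> nat.
Proof.
rewrite /adj; case: tpermP => [->|->|/eqP nlo /eqP nhi] /=; rewrite ?eqxx //.
  by rewrite /bump /= (gtn_eqF (leqnn _)).
by move: nlo nhi; rewrite -!val_eqE /= => /negPf-> /negPf->.
Qed.

Lemma adjJ i j : adj i * adj j * adj i = tperm (adj i (lo j)) (adj i (hi j)).
Proof. by rewrite -tpermJ conjgE adjV mulgA. Qed.

Lemma adj_far i j :
  (i.+1 < j)%N || (j.+1 < i)%N -> adj i * adj j = adj j * adj i.
Proof.
move=> far; apply: (mulIg (adj i)); rewrite -(mulgA _ (adj i)) adjK mulg1 adjJ.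
by congr tperm; apply: val_inj; rewrite /= adj_val /= /bump /=;
   do 2?[case: eqP => /= ?]; lia.
Qed.

Lemma adj_near i j :
  (i.+1 == j) || (j.+1 == i) -> adj i * adj j * adj i = adj j * adj i * adj j.
Proof.
wlog ij : i j / i.+1 = j => [hw /orP[/eqP|/eqP] ij|_].
- by apply: hw; rewrite // ij eqxx.
- by symmetry; apply: hw; rewrite // ij eqxx.
rewrite !adjJ; congr tperm; apply: val_inj; rewrite /= !adj_val /= /bump /=;
  by do 4?[case: eqP => /= ?]; lia.
Qed.

Definition inversions x : {set 'I_m.+1 * 'I_m.+1} :=
  [set p : 'I_m.+1 * 'I_m.+1 | (p.1 < p.2)%N && (x p.2 < x p.1)%N].

Definition len x : nat := #|inversions x|.

Definition descent i x : bool := (x (hi i) < x (lo i))%N.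

Lemma len1 : len 1 = 0%N.
Proof.
apply: eq_card0 => -[k l]; rewrite !inE !perm1 /=.
by case: ltngtP.
Qed.

Lemma adj_mono i (k l : 'I_m.+1) :
  (k, l) != (lo i, hi i) -> (k < l)%N -> (adj i k < adj i l)%N.
Proof.
rewrite xpair_eqE -!val_eqE /= !adj_val /bump /=.
by do 4?[case: eqP => /= ?]; lia.
Qed.

Lemma descentN i x : ~~ descent i x = (x (lo i) < x (hi i))%N.
Proof.
rewrite /descent -leqNgt leq_eqVlt; case: eqP => //= /val_inj/perm_inj.
by move/(congr1 val) => /=; rewrite /bump /=; lia.
Qed.

Lemma descent_adj i x : descent i (adj i * x) = ~~ descent i x.
Proof. by rewrite descentN /descent !permM tpermL tpermR. Qed.

(** On the left, adj i exchanges the positions i and i+1.  So it transports the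
    inversions of x and creates one more, at these two positions. *)
Lemma len_asc i x : ~~ descent i x -> len (adj i * x) = (len x).+1.
Proof.
rewrite descentN => asc.
pose f (p : 'I_m.+1 * 'I_m.+1) := (adj i p.1, adj i p.2).
have fK : involutive f by move=> [k l]; rewrite /f /= -!permM adjK !perm1.
have -> : len (adj i * x) = #|(lo i, hi i) |: (f @: inversions x)|.
  congr #|pred_of_set _|; apply/setP=> -[k l]; rewrite !inE.
  case: eqP => [[-> ->]|/eqP ne] /=.
    by rewrite !permM /adj tpermL tpermR asc /= /bump /= andbT; lia.
  rewrite -[(k, l) in RHS]fK mem_imset ?inE; last exact: inv_inj.
  rewrite /f /= !permM; case: (eqVneq (k, l) (hi i, lo i)) => [[-> ->]|ne'].
    by rewrite /adj tpermL tpermR /= /bump /=; lia.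
  congr andb; apply/idP/idP => [|lt]; first exact: adj_mono.
  have := @adj_mono i (adj i k) (adj i l).
  rewrite -!permM adjK !perm1; apply=> //; apply: contraNneq ne' => -[ek el].
  have [-> ->] : k = adj i (adj i k) /\ l = adj i (adj i l).
    by rewrite -!permM adjK !perm1.
  by rewrite ek el /adj tpermL tpermR.
rewrite cardsU1 (card_imset _ (inv_inj fK)).
suff -> : (lo i, hi i) \notin f @: inversions x by rewrite add1n.
apply/imsetP=> -[p pinv /(congr1 f)]; rewrite fK /f /= /adj tpermL tpermR => ep.
by move: pinv; rewrite -ep inE /= /bump /=; lia.
Qed.

Lemma len_desc i x : descent i x -> len x = (len (adj i * x)).+1.
Proof.
move=> d; rewrite -(@len_asc i) ?mulgA ?adjK ?mul1g //.
by rewrite descent_adj d.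
Qed.

Lemma ex_descent x : x != 1 -> exists i, descent i x.
Proof.
move=> x1; apply/existsP; apply: contraNT x1; rewrite negb_exists => /forallP asc.
have {}asc (k l : 'I_m.+1) : k.+1 = l -> (x k < x l)%N.
  move=> kl; have km : (k < m)%N by move: (valP l); rewrite /= -kl.
  move: (asc (Ordinal km)); rewrite descentN.
  by congr (x _ < x _)%N; apply: val_inj => //=; rewrite /bump.
have lower d (k : 'I_m.+1) : k = d :> nat -> (k <= x k)%N.
  elim: d k => [|d IH] k kd; first by rewrite kd.
  have dm : (d < m.+1)%N by move: (valP k) => /=; lia.
  have := asc (Ordinal dm) k (esym kd); have := IH (Ordinal dm) erefl => /=; lia.
have upper d (k : 'I_m.+1) : (k + d = m)%N -> (x k <= k)%N.
  elim: d k => [|d IH] k kd; first by move: (valP (x k)) => /=; lia.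
  have km : (k.+1 < m.+1)%N by lia.
  have := asc k (Ordinal km) erefl; have /= := IH (Ordinal km); lia.
apply/eqP/permP=> k; apply: val_inj; rewrite perm1; apply/eqP.
rewrite eqn_leq (lower k) // (upper (m - k)%N) //.
by move: (valP k) => /=; lia.
Qed.

Definition perm_of w : 'S_m.+1 := \prod_(i <- w) adj i.

Lemma perm_of_nil : perm_of [::] = 1. Proof. exact: big_nil. Qed.
Lemma perm_of_cons i w : perm_of (i :: w) = adj i * perm_of w.
Proof. exact: big_cons. Qed.
Lemma perm_of_cat w1 w2 : perm_of (w1 ++ w2) = perm_of w1 * perm_of w2.
Proof. exact: big_cat. Qed.
Lemma perm_of_rev w : perm_of (rev w) = (perm_of w)^-1.
Proof.
elim: w => [|i w IH]; first by rewrite /rev /= perm_of_nil invg1.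
by rewrite rev_cons -cats1 perm_of_cat !perm_of_cons perm_of_nil mulg1 IH invMg adjV.
Qed.

(** With [ex_word], this makes len the word length for the generators adj i,
    whence its subadditivity and its invariance under inversion. *)
Lemma len_perm_of w : (len (perm_of w) <= size w)%N.
Proof.
elim: w => [|i w IH]; first by rewrite perm_of_nil len1.
rewrite perm_of_cons /=; case: (boolP (descent i (perm_of w))) => d.
  by move/len_desc: d; lia.
by rewrite len_asc.
Qed.

Lemma ex_word x : exists w, (perm_of w == x) && (size w == len x).
Proof.
have [d] := ubnP (len x); elim: d x => // d IH x lt.
have [->|/ex_descent[i di]] := eqVneq x 1.
  by exists [::]; rewrite perm_of_nil len1 !eqxx.
have lx := len_desc di; have [|w /andP[/eqP pw /eqP sw]] := IH (adj i * x); first lia.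
exists (i :: w); rewrite perm_of_cons pw mulgA adjK mul1g eqxx /= sw; lia.
Qed.

Lemma len_eq0 x : (len x == 0%N) = (x == 1).
Proof.
apply/eqP/eqP=> [l0|->]; last exact: len1.
have [w /andP[/eqP pw]] := ex_word x; rewrite l0 => /eqP/size0nil w0.
by rewrite -pw w0 perm_of_nil.
Qed.

Lemma lenV x : len x^-1 = len x.
Proof.
have half y : (len y^-1 <= len y)%N.
  have [w /andP[/eqP<- /eqP<-]] := ex_word y.
  by rewrite -perm_of_rev -(size_rev w) len_perm_of.
by apply/eqP; rewrite eqn_leq half -{1}[x]invgK half.
Qed.

Lemma len_mul x y : (len (x * y) <= len x + len y)%N.
Proof.
have [v /andP[/eqP<- /eqP<-]] := ex_word x.
have [w /andP[/eqP<- /eqP<-]] := ex_word y.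
by rewrite -perm_of_cat -size_cat len_perm_of.
Qed.

(** The weak order: y is x followed by a permutation, with lengths adding.  It
    becomes left divisibility of simple braids. *)
Definition wle x y : bool := len y == (len x + len (x^-1 * y))%N.
Local Notation "x <=w y" := (wle x y) (at level 70).

Lemma wle_refl x : x <=w x. Proof. by rewrite /wle mulVg len1 addn0. Qed.
Lemma wle1 x : 1 <=w x. Proof. by rewrite /wle invg1 mul1g len1. Qed.
Lemma wle_len x y : x <=w y -> (len x <= len y)%N.
Proof. by move/eqP->; rewrite leq_addr. Qed.
Lemma wle_eq x y : x <=w y -> (len y <= len x)%N -> x = y.
Proof.
move=> /eqP-> le; apply: (mulgI x^-1); rewrite mulVg; apply/esym/eqP.
by rewrite -len_eq0 -leqn0 -(leq_add2l (len x)) addn0.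
Qed.
Lemma wle_anti x y : x <=w y -> y <=w x -> x = y.
Proof. by move=> xy /wle_len; exact: wle_eq. Qed.
(** len (x^-1 * y) is a left-invariant distance, and x <=w y says that x lies on
    a geodesic from 1 to y. *)
Lemma len_tri x y z : (len (x^-1 * z) <= len (x^-1 * y) + len (y^-1 * z))%N.
Proof. by rewrite -[z in leqLHS](mulKVg y) mulgA len_mul. Qed.

Lemma len_tri1 x y : (len y <= len x + len (x^-1 * y))%N.
Proof. by have := len_tri 1 x y; rewrite invg1 !mul1g. Qed.

Lemma wle_trans y x z : x <=w y -> y <=w z -> x <=w z.
Proof.
rewrite /wle => /eqP xy /eqP yz.
by have := len_tri x y z; have := len_tri1 x z; lia.
Qed.

(** For e <=w y, the points of geodesics from e to y are the translates by e of
    those from 1 to e^-1 * y. *)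
Lemma wle_mulr e x y : e <=w y -> x <=w e^-1 * y -> e <=w e * x /\ e * x <=w y.
Proof.
rewrite /wle => /eqP ey /eqP xy; have tri1 := len_tri1 e (e * x).
have tri2 := len_tri1 (e * x) y.
have ex : len (e^-1 * (e * x)) = len x by rewrite mulKg.
have exy : len ((e * x)^-1 * y) = len (x^-1 * (e^-1 * y)) by rewrite invMg mulgA.
lia.
Qed.

Lemma wle_mulV e x y : e <=w e * x -> e * x <=w y -> x <=w e^-1 * y.
Proof.
move=> ex exy; have := wle_trans ex exy; move: ex exy; rewrite /wle.
have -> : len (e^-1 * (e * x)) = len x by rewrite mulKg.
have -> : len ((e * x)^-1 * y) = len (x^-1 * (e^-1 * y)) by rewrite invMg mulgA.
lia.
Qed.

Lemma wle_mul2l e x y : e <=w e * y -> x <=w y -> e * x <=w e * y.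
Proof. by move=> ey xy; have [] := @wle_mulr e x (e * y); rewrite ?mulKg. Qed.

Lemma len_adj i : len (adj i) = 1%N.
Proof.
rewrite -[adj i]mulg1 len_asc ?len1 // descentN !perm1 /= /bump /=; lia.
Qed.

Lemma descent_wle i x : descent i x = (adj i <=w x).
Proof.
have -> : (adj i <=w x) = (len x == (len (adj i * x)).+1) by rewrite /wle len_adj adjV.
case: (boolP (descent i x)) => [/len_desc->|/len_asc->]; first by rewrite eqxx.
lia.
Qed.

Lemma wle_cover x y : x <=w y -> x != y ->
  exists i, x <=w x * adj i /\ x * adj i <=w y.
Proof.
move=> xy ne; have [|i] := @ex_descent (x^-1 * y).
  by rewrite -eq_mulVg1.
by rewrite descent_wle => /(wle_mulr xy); exists i.
Qed.

Lemma adjL i : adj i (lo i) = hi i. Proof. exact: tpermL. Qed.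
Lemma adjR i : adj i (hi i) = lo i. Proof. exact: tpermR. Qed.
Lemma adjD i (k : 'I_m.+1) : k != i :> nat -> k != i.+1 :> nat -> adj i k = k.
Proof. by move=> /negPf ni /negPf ni1; apply: val_inj; rewrite /= adj_val ni ni1. Qed.

Definition top : 'S_m.+1 := perm (@rev_ord_inj m.+1).

Lemma top_val (k : 'I_m.+1) : top k = (m - k)%N :> nat.
Proof. by rewrite permE /= subSS. Qed.

Lemma inversions_top : inversions top = [set p : 'I_m.+1 * 'I_m.+1 | (p.1 < p.2)%N].
Proof.
apply/setP=> -[k l]; rewrite !inE /= !top_val.
by move: (valP k) (valP l) => /=; lia.
Qed.

(** Following y by top exchanges inversions with non-inversions, so that
    len (y * top) and len y add up to the number of all pairs. *)
Lemma wle_top x : x <=w top.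
Proof.
suff lt y : len (y * top) + len y = len top.
  by rewrite /wle -(lt x^-1) lenV addnC.
rewrite /len inversions_top -[RHS](cardsID (inversions y)) addnC; congr (_ + _)%N.
  congr #|pred_of_set _|; apply/setP=> -[k l]; rewrite !inE /=; lia.
congr #|pred_of_set _|; apply/setP=> -[k l]; rewrite !inE /= !permM !top_val.
have ne : (k < l)%N -> y k != y l :> nat.
  by apply: contraTneq => /val_inj/perm_inj->; rewrite ltnn.
by move: (valP (y k)) (valP (y l)) => /=; case: ltnP ne => //= _ /(_ isT); lia.
Qed.

Lemma adj_conj_top i : adj i * top = top * adj (rev_ord i).
Proof.
apply: (mulIg (adj (rev_ord i))); rewrite -[RHS]mulgA adjK mulg1.
apply/permP=> k; apply: val_inj; rewrite /= !permM adj_val /= !top_val adj_val.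
by move: (valP k) (valP i) => /=; case: (k =P i :> nat) => ?; case: (k =P i.+1 :> nat) => ?;
  do 2?[case: eqP => /= ?]; lia.
Qed.

End Length.

Notation "x <=w y" := (wle x y) (at level 70).

(** * Positive braid words, meets in the weak order, reduced words *)
Section BraidMonoid.
Variable m : nat.
Implicit Types (i j : 'I_m) (x y z a b c e v : 'S_m.+1) (w : seq 'I_m).

Inductive pos_eq : seq 'I_m -> seq 'I_m -> Prop :=
| pos_eq_refl w : pos_eq w w
| pos_eq_sym w1 w2 : pos_eq w1 w2 -> pos_eq w2 w1
| pos_eq_trans w2 w1 w3 : pos_eq w1 w2 -> pos_eq w2 w3 -> pos_eq w1 w3
| pos_eq_cat w1 w1' w2 w2' :
    pos_eq w1 w1' -> pos_eq w2 w2' -> pos_eq (w1 ++ w2) (w1' ++ w2')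
| pos_eq_far i j : (i.+1 < j)%N || (j.+1 < i)%N -> pos_eq [:: i; j] [:: j; i]
| pos_eq_near i j : (i.+1 == j) || (j.+1 == i) ->
    pos_eq [:: i; j; i] [:: j; i; j].

Lemma pos_eq_size w1 w2 : pos_eq w1 w2 -> size w1 = size w2.
Proof. by elim=> // {w1 w2} *; rewrite ?size_cat; congruence. Qed.

Lemma pos_eq_perm w1 w2 : pos_eq w1 w2 -> perm_of w1 = perm_of w2.
Proof.
elim=> // {w1 w2} [_ w _ _ -> _ ->|v v' w w' _ vv' _ ww'|i j far|i j near] //.
- by rewrite !perm_of_cat vv' ww'.
- by rewrite !perm_of_cons perm_of_nil !mulg1 adj_far.
- by rewrite !perm_of_cons perm_of_nil !mulg1 !mulgA adj_near.
Qed.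

Definition reduced w := len (perm_of w) == size w.

Lemma reduced_cat w1 w2 : reduced (w1 ++ w2) -> reduced w1 && reduced w2.
Proof.
rewrite /reduced perm_of_cat size_cat => /eqP l12.
have := len_mul (perm_of w1) (perm_of w2).
have := len_perm_of w1; have := len_perm_of w2; lia.
Qed.

Lemma reduced_cat_wle w1 w2 :
  reduced (w1 ++ w2) -> perm_of w1 <=w perm_of (w1 ++ w2).
Proof.
move=> r12; have [/eqP r1 /eqP r2] := andP (reduced_cat r12).
by rewrite /wle (eqP r12) perm_of_cat mulKg r1 r2 size_cat.
Qed.

Lemma adj_wle i w : reduced (i :: w) -> adj i <=w perm_of (i :: w).
Proof.
by move/(@reduced_cat_wle [:: i]); rewrite {1}perm_of_cons perm_of_nil mulg1.
Qed.

Lemma ex_reduced v : exists w, (perm_of w == v) && reduced w.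
Proof.
have [w /andP[/eqP pw sw]] := ex_word v; exists w.
by rewrite /reduced pw eqxx /= eq_sym.
Qed.

Lemma pos_eq_reduced w1 w2 : pos_eq w1 w2 -> reduced w1 = reduced w2.
Proof. by move=> eq12; rewrite /reduced (pos_eq_perm eq12) (pos_eq_size eq12). Qed.

Lemma reduced_cons i w : reduced w -> ~~ descent i (perm_of w) -> reduced (i :: w).
Proof. by rewrite /reduced perm_of_cons => /eqP rw /len_asc->; rewrite rw. Qed.

Lemma reduced1 i : reduced [:: i].
Proof. by rewrite /reduced perm_of_cons perm_of_nil mulg1 len_adj. Qed.

Lemma reduced_far i j : (i.+1 < j)%N || (j.+1 < i)%N -> reduced [:: i; j].
Proof.
move=> far; apply: reduced_cons; first exact: reduced1.
rewrite perm_of_cons perm_of_nil mulg1 /descent !adjD //= /bump /=; lia.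
Qed.

Lemma reduced_near i j : (i.+1 == j) || (j.+1 == i) -> reduced [:: i; j; i].
Proof.
wlog ij : i j / i.+1 = j => [hw near|near].
  case/orP: (near) => /eqP ij; first exact: hw.
  by rewrite -(pos_eq_reduced (pos_eq_near _)) ?hw // orbC.
have hl : hi i = lo j by apply: val_inj; rewrite /= /bump /= -ij.
have ih : adj i (hi j) = hi j by apply: adjD; rewrite /= /bump /=; lia.
have jl : adj j (lo i) = lo i by apply: adjD; rewrite /=; lia.
apply: reduced_cons; [apply: reduced_cons; first exact: reduced1|];
  rewrite !perm_of_cons perm_of_nil mulg1.
  by rewrite /descent ih -hl adjR /= /bump /=; lia.
by rewrite /descent !permM jl adjL hl adjL ih -hl /= /bump /=; lia.
Qed.

(** The rank-two fact behind both Matsumoto's theorem and the existence of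
    meets: if adj i and adj j lie below v, so does the common permutation of the
    two sides of the braid relation between i and j. *)
Lemma adj_join i j :
  exists w1 w2, [/\ pos_eq (i :: w1) (j :: w2), reduced (i :: w1) &
    forall v, adj i <=w v -> adj j <=w v -> perm_of (i :: w1) <=w v].
Proof.
have push k e v : descent k v -> e <=w adj k * v -> adj k * e <=w v.
  by rewrite descent_wle -{2}(adjV k) => kv /(wle_mulr kv)[].
wlog ij : i j / (i <= j)%N => [hw|].
  have [/hw//|/ltnW/hw[w1 [w2 [eq12 red12 least]]]] := leqP i j.
  exists w2, w1; split; first exact: pos_eq_sym.
    by rewrite -(pos_eq_reduced eq12).
  by move=> v vi vj; rewrite -(pos_eq_perm eq12); exact: least.
move: ij; rewrite leq_eqVlt => /orP[/eqP/val_inj<-|].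
  exists [::], [::]; split; rewrite ?reduced1 //; first exact: pos_eq_refl.
  by move=> v; rewrite perm_of_cons perm_of_nil mulg1.
rewrite leq_eqVlt => /orP[ij|far].
  exists [:: j; i], [:: i; j].
  have near : (i.+1 == j) || (j.+1 == i) by rewrite ij.
  split; [exact: pos_eq_near | exact: reduced_near |].
  have hl : hi i = lo j by apply: val_inj; rewrite /= /bump /= -(eqP ij).
  have ih : adj i (hi j) = hi j by apply: adjD; rewrite /= /bump /=; lia.
  have jl : adj j (lo i) = lo i by apply: adjD; rewrite /=; lia.
  move=> v; rewrite -!descent_wle !perm_of_cons perm_of_nil mulg1 => di dj.
  apply: (push) => //; have dj' : descent j (adj i * v).
    rewrite /descent !permM ih -hl adjR.
    by apply: ltn_trans di; rewrite hl.
  apply: (push) => //; rewrite -descent_wle /descent !permM hl adjL ih jl adjL hl.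
  exact: dj.
have far' : (i.+1 < j)%N || (j.+1 < i)%N by rewrite far.
exists [:: j], [:: i]; split; [exact: pos_eq_far | exact: reduced_far |].
move=> v; rewrite -!descent_wle !perm_of_cons perm_of_nil mulg1 => di dj.
apply: (push) => //; rewrite -descent_wle /descent !permM !adjD //= /bump /=; lia.
Qed.

(** A confluence argument.  For each common lower bound e of a and b, the
    common lower bounds above e have a greatest element, by induction on the
    distance from e to a: the elements found above two covers e * adj i and
    e * adj j coincide, because [adj_join] gives a common lower bound of a and b
    above both covers. *)
Lemma ex_meet a b : exists c, [/\ c <=w a, c <=w b &
  forall x, x <=w a -> x <=w b -> x <=w c].
Proof.
pose D x := (x <=w a) && (x <=w b).
suff H e : D e -> exists2 c, D c /\ e <=w c & forall x, D x -> e <=w x -> x <=w c.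
  have [|c [/andP[ca cb] _] cmax] := H 1; first by rewrite /D !wle1.
  by exists c; split=> // x xa xb; apply: cmax (wle1 x); rewrite /D xa.
have [d] := ubnP (len a - len e); elim: d e => // d IH e lt De.
have [ea eb] := andP De.
have extend i : e <=w e * adj i -> D (e * adj i) ->
    exists2 c, D c /\ e * adj i <=w c & forall x, D x -> e * adj i <=w x -> x <=w c.
  move=> ei Di; have [/wle_len le _] := andP Di; apply: IH Di.
  have: len (e * adj i) = (len e).+1 by rewrite (eqP ei) mulKg len_adj addn1.
  lia.
have [/existsP[i /andP[ei Di]]|none] :=
    boolP [exists i, (e <=w e * adj i) && D (e * adj i)]; last first.
  exists e; rewrite ?wle_refl // => x /andP[xa xb] ex.
  have [->|ne] := eqVneq x e; first exact: wle_refl.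
  have [|i [ei ix]] := wle_cover ex; first by rewrite eq_sym.
  case/existsP: none; exists i.
  by rewrite ei /D (wle_trans ix xa) (wle_trans ix xb).
have [c [Dc ic] cmax] := extend i ei Di.
exists c; first by rewrite (wle_trans ei).
move=> x Dx ex; have [<-|ne] := eqVneq e x; first exact: wle_trans ei ic.
have [j [ej jx]] := wle_cover ex ne; have [xa xb] := andP Dx.
have Dj : D (e * adj j) by rewrite /D !(wle_trans jx).
have [c' [Dc' jc'] c'max] := extend j ej Dj.
have [w1 [w2 [eq12 red1 ymin]]] := adj_join i j; set y := perm_of _ in ymin.
have iy : adj i <=w y by exact: adj_wle.
have jy : adj j <=w y.
  by rewrite /y (pos_eq_perm eq12); apply: adj_wle; rewrite -(pos_eq_reduced eq12).
have join v : e <=w v -> e * adj i <=w v -> e * adj j <=w v -> e <=w e * y /\ e * y <=w v.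
  by move=> ev iv jv; apply: wle_mulr ev (ymin _ _ _); exact: wle_mulV.
have [[/andP[ia ib] /andP[ja jb]]] := (Di, Dj).
have [[ey ya] [_ yb]] := (join a ea ia ja, join b eb ib jb).
have Dy : D (e * y) by rewrite /D ya.
have yi : e * adj i <=w e * y by exact: wle_mul2l.
have yj : e * adj j <=w e * y by exact: wle_mul2l.
have -> : c = c'; last exact: c'max.
apply: wle_anti; [apply: c'max | apply: cmax] => //.
- exact: wle_trans yj (cmax _ Dy yi).
- exact: wle_trans yi (c'max _ Dy yj).
Qed.

Definition pos_eqb : rel (seq 'I_m) := fun w1 w2 => `[< pos_eq w1 w2 >].

Lemma pos_eqb_refl : reflexive pos_eqb.
Proof. by move=> w; apply/asboolP; exact: pos_eq_refl. Qed.

Lemma pos_eqb_sym : symmetric pos_eqb.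
Proof. by move=> w1 w2; apply/asboolP/asboolP; exact: pos_eq_sym. Qed.

Lemma pos_eqb_trans : transitive pos_eqb.
Proof.
move=> w2 w1 w3 /asboolP eq12 /asboolP eq23; apply/asboolP.
exact: pos_eq_trans eq23.
Qed.

Canonical pos_equiv := EquivRel pos_eqb pos_eqb_refl pos_eqb_sym pos_eqb_trans.

(** Equalities are first proved in the monoid with Artin's presentation, where
    lengths and heads make sense, and then transferred to the group. *)
Definition bmonoid := {eq_quot pos_equiv}.
HB.instance Definition _ := Choice.on bmonoid.
HB.instance Definition _ := EqQuotient.on bmonoid.

Definition cl w : bmonoid := \pi w.

Lemma cl_eq w1 w2 : pos_eq w1 w2 <-> cl w1 = cl w2.
Proof.
by split=> [eq12 | /eqmodP/asboolP//]; apply/eqmodP; exact/asboolP.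
Qed.

Lemma cl_repr (p : bmonoid) : cl (generic_quotient.repr p) = p.
Proof. exact: reprK. Qed.

Definition bmonoid_mul (p q : bmonoid) : bmonoid :=
  cl (generic_quotient.repr p ++ generic_quotient.repr q).

Lemma bmonoid_mulE w1 w2 : bmonoid_mul (cl w1) (cl w2) = cl (w1 ++ w2).
Proof. by apply/cl_eq/pos_eq_cat; apply/cl_eq; exact: cl_repr. Qed.

Lemma bmonoid_mulA : associative bmonoid_mul.
Proof.
move=> p q r; rewrite -[p]cl_repr -[q]cl_repr -[r]cl_repr.
by rewrite !bmonoid_mulE catA.
Qed.

Lemma bmonoid_mul1 : left_id (cl [::]) bmonoid_mul.
Proof. by move=> p; rewrite -[p]cl_repr bmonoid_mulE. Qed.

Lemma bmonoid_mulr1 : right_id (cl [::]) bmonoid_mul.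
Proof. by move=> p; rewrite -[p]cl_repr bmonoid_mulE cats0. Qed.

HB.instance Definition _ := isMonoid.Build bmonoid
  bmonoid_mulA bmonoid_mul1 bmonoid_mulr1.

Lemma cl_nil : cl [::] = 1. Proof. by []. Qed.

Lemma cl_cat w1 w2 : cl (w1 ++ w2) = cl w1 * cl w2.
Proof. by rewrite -bmonoid_mulE. Qed.

Definition gen i : bmonoid := cl [:: i].

Lemma cl_cons i w : cl (i :: w) = gen i * cl w.
Proof. by rewrite -cat1s cl_cat. Qed.

(** By induction on the length.  If the first letters i and j differ, both are
    descents of the permutation p of the two words, so p lies above the join of
    adj i and adj j; this gives reduced words of p that begin with the two sides
    of the braid relation between i and j, and each of them shares its first
    letter with one of the given words. *)
Lemma matsumoto w1 w2 : reduced w1 -> reduced w2 -> perm_of w1 = perm_of w2 ->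
  cl w1 = cl w2.
Proof.
have [d] := ubnP (size w1); elim: d w1 w2 => // d IH w1 w2 lt r1 r2 p12.
have s12 : size w1 = size w2 by rewrite -(eqP r1) p12 (eqP r2).
case: w1 w2 => [|i w1] [|j w2] // in lt r1 r2 p12 s12 *.
have [/andP[_ r1'] /andP[_ r2']] := (@reduced_cat [:: i] w1 r1, @reduced_cat [:: j] w2 r2).
have [u1 [u2 [eq12 redu least]]] := adj_join i j.
have IHi k w u : size w = size w1 -> reduced (k :: w) -> reduced (k :: u) ->
    perm_of (k :: w) = perm_of (k :: u) -> cl (k :: w) = cl (k :: u).
  move=> sw /(@reduced_cat [:: k])/andP[_ rw] /(@reduced_cat [:: k])/andP[_ ru] pwu.
  rewrite !cl_cons; congr (_ * _); apply: IH => //; first by rewrite sw.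
  by move: pwu; rewrite !perm_of_cons => /mulgI.
(* Both words are connected through reduced words starting with i :: u1 and
   j :: u2. *)
have [] := (adj_wle r1, adj_wle r2); rewrite -p12 => ip jp.
have ple := least _ ip jp; set p := perm_of (i :: w1) in p12 ip jp ple.
have [w /andP[/eqP pw redw]] := ex_reduced ((perm_of (i :: u1))^-1 * p).
have pE : perm_of ((i :: u1) ++ w) = p by rewrite perm_of_cat pw mulKVg.
have redE : reduced ((i :: u1) ++ w).
  by rewrite /reduced pE (eqP ple) size_cat (eqP redu) -pw (eqP redw).
have eqE : pos_eq ((i :: u1) ++ w) ((j :: u2) ++ w).
  by apply: pos_eq_cat eq12 _; exact: pos_eq_refl.
transitivity (cl ((i :: u1) ++ w)); first exact: IHi.
transitivity (cl ((j :: u2) ++ w)); first exact/cl_eq.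
apply/esym/IHi => //; first by case: s12.
  by rewrite -(pos_eq_reduced eqE).
by rewrite -p12 -pE (pos_eq_perm eqE).
Qed.

End BraidMonoid.

(** * Permutation braids and the head of a positive word *)
Section Head.
Variable m : nat.
Implicit Types (i j : 'I_m) (x y z a b c e v : 'S_m.+1) (w : seq 'I_m).

Definition word_of v : seq 'I_m := xchoose (ex_reduced v).

Lemma perm_word v : perm_of (word_of v) = v.
Proof. by have /andP[/eqP] := xchooseP (ex_reduced v). Qed.

Lemma reduced_word v : reduced (word_of v).
Proof. by have /andP[] := xchooseP (ex_reduced v). Qed.

Definition pbraid v : bmonoid m := cl (word_of v).

Lemma pbraid_perm w : reduced w -> pbraid (perm_of w) = cl w.
Proof. by move=> rw; apply: matsumoto (reduced_word _) rw (perm_word _). Qed.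

Lemma pbraid_mul x y : x <=w x * y -> pbraid (x * y) = pbraid x * pbraid y.
Proof.
rewrite -{1 2 3}(perm_word x) -{1 2}(perm_word y) -perm_of_cat -cl_cat => le.
apply: pbraid_perm; have := eqP le.
rewrite perm_of_cat mulKg (eqP (reduced_word x)) (eqP (reduced_word y)).
by rewrite /reduced perm_of_cat size_cat => ->.
Qed.

Lemma pbraid1 : pbraid 1 = 1.
Proof. by rewrite -(perm_of_nil m) pbraid_perm ?cl_nil // /reduced perm_of_nil len1. Qed.

Lemma pbraid_adj i : pbraid (adj i) = gen i.
Proof.
rewrite -[adj i]mulg1 -(perm_of_nil m) -perm_of_cons pbraid_perm //.
by rewrite /reduced perm_of_cons perm_of_nil mulg1 len_adj.
Qed.

Definition meet a b : 'S_m.+1 := projT1 (cid (ex_meet a b)).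

Lemma meetP a b : [/\ meet a b <=w a, meet a b <=w b &
  forall x, x <=w a -> x <=w b -> x <=w meet a b].
Proof. exact: projT2 (cid (ex_meet a b)). Qed.

Lemma meetl a b : meet a b <=w a. Proof. by have [] := meetP a b. Qed.
Lemma meetr a b : meet a b <=w b. Proof. by have [] := meetP a b. Qed.
Lemma le_meet x a b : x <=w a -> x <=w b -> x <=w meet a b.
Proof. by have [_ _] := meetP a b; apply. Qed.

(** The largest part of a that a left factor x can absorb while the lengths of
    the factors still add.  If a is the head of a positive braid z, then act x a
    is the head of x * z, and rest x a is what it leaves of a. *)
Definition room x a := meet a (x^-1 * top m).
Definition act x a := x * room x a.
Definition rest x a := (room x a)^-1 * a.

Lemma wle_act x a : x <=w act x a.
Proof. by have [] := wle_mulr (wle_top x) (meetr a (x^-1 * top m)). Qed.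

Lemma top_rest_mul x y : x <=w x * y ->
  [/\ y <=w x^-1 * top m, y <=w y * ((x * y)^-1 * top m),
      y * ((x * y)^-1 * top m) = x^-1 * top m &
      (x * y)^-1 * top m <=w y^-1 * top m].
Proof.
move=> xy; have yx : y <=w x^-1 * top m by exact: wle_mulV (wle_top _).
have yE : y * ((x * y)^-1 * top m) = x^-1 * top m by rewrite invMg -mulgA mulKVg.
rewrite yE; split=> //; apply: wle_mulV; first by rewrite yE.
exact: wle_top.
Qed.

Lemma room_mul_le x y a : x <=w x * y -> room (x * y) a <=w room y a.
Proof.
case/top_rest_mul=> _ _ _ le.
by apply: le_meet (meetl _ _) (wle_trans (meetr _ _) le).
Qed.

(** Absorbing by y, then by x, amounts to absorbing by x * y, since a translation
    by y is an isomorphism onto the permutations above y and so preserves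
    meets. *)
Lemma room_act x y a : x <=w x * y -> y * room (x * y) a = room x (act y a).
Proof.
move=> xy; have [yx yxs yE cle] := top_rest_mul xy.
have yr : y <=w y * room (x * y) a.
  by have [] := wle_mulr (wle_top y) (wle_trans (meetr a _) cle).
apply: wle_anti.
  apply: le_meet; first exact: wle_mul2l (wle_act y a) (room_mul_le a xy).
  by rewrite -yE; apply: wle_mul2l (meetr _ _).
have yle : y <=w room x (act y a) by apply: le_meet => //; exact: wle_act.
rewrite -[room x _](mulKVg y) in yle *; set q := y^-1 * _ in yle *.
have qle : y * q <=w act y a by rewrite mulKVg meetl.
have qle' : y * q <=w x^-1 * top m by rewrite mulKVg meetr.
apply: wle_mul2l => //; have cut z : y * q <=w y * z -> q <=w z.
  by move=> le; rewrite -[z](mulKg y); exact: wle_mulV.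
apply: le_meet; last by apply: cut; rewrite yE.
exact: wle_trans (cut _ qle) (meetl _ _).
Qed.

(** This and [pbraid_rest_mul] say that permutations act on pairs of a head and a
    cofactor, as long as lengths add. *)
Lemma act_mul x y a : x <=w x * y -> act (x * y) a = act x (act y a).
Proof. by move=> xy; rewrite {1}/act -mulgA room_act. Qed.

Lemma pbraid_rest x a : pbraid a = pbraid (room x a) * pbraid (rest x a).
Proof. by rewrite -pbraid_mul mulKVg // meetl. Qed.

Lemma pbraid_rest_mul x y a : x <=w x * y ->
  pbraid (rest (x * y) a) = pbraid (rest x (act y a)) * pbraid (rest y a).
Proof.
move=> xy; have restE : rest x (act y a) = (room (x * y) a)^-1 * room y a.
  by rewrite /rest -room_act // invMg -mulgA mulKg.
have prodE : rest x (act y a) * rest y a = rest (x * y) a.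
  by rewrite restE -mulgA mulKVg.
rewrite -prodE pbraid_mul // prodE restE; apply: wle_mulV; rewrite mulKVg.
  exact: room_mul_le.
exact: meetl.
Qed.

Lemma room_top a : room (top m) a = 1.
Proof.
apply/eqP; rewrite -len_eq0 -leqn0 -(len1 m) -(mulVg (top m)).
exact/wle_len/meetr.
Qed.

Lemma rest_top a : rest (top m) a = a.
Proof. by rewrite /rest room_top invg1 mul1g. Qed.

Fixpoint head_perm w : 'S_m.+1 :=
  if w is i :: w' then act (adj i) (head_perm w') else 1.

Fixpoint head_tail w : bmonoid m :=
  if w is i :: w' then pbraid (rest (adj i) (head_perm w')) * head_tail w' else 1.

Lemma cl_head_tail w : cl w = pbraid (head_perm w) * head_tail w.
Proof.
elim: w => [|i w IH] /=; first by rewrite pbraid1 mul1g.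
rewrite cl_cons IH (pbraid_rest (adj i)) !mulgA; congr (_ * _ * _).
by rewrite /act pbraid_mul ?pbraid_adj //; exact: wle_act.
Qed.

(** A reduced word acts on heads and cofactors through its permutation only.
    As the two sides of a braid relation are reduced words of one permutation,
    heads and cofactors are invariants of positive braids. *)
Lemma head_cat_reduced w1 w2 : reduced w1 ->
  head_perm (w1 ++ w2) = act (perm_of w1) (head_perm w2) /\
  head_tail (w1 ++ w2) = pbraid (rest (perm_of w1) (head_perm w2)) * head_tail w2.
Proof.
elim: w1 => [_|i w1 IH r1] /=.
  have r1 : room 1 (head_perm w2) = head_perm w2.
    apply: wle_anti (meetl _ _) (le_meet (wle_refl _) _).
    by rewrite invg1 mul1g wle_top.
  by rewrite perm_of_nil /rest /act r1 mul1g mulVg pbraid1 mul1g.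
have [_ r1'] := andP (@reduced_cat _ [:: i] w1 r1).
have [-> ->] := IH r1'; rewrite perm_of_cons.
have le : adj i <=w adj i * perm_of w1 by rewrite -perm_of_cons adj_wle.
by rewrite act_mul // pbraid_rest_mul // mulgA.
Qed.

Lemma head_pos_eq w1 w2 : pos_eq w1 w2 ->
  head_perm w1 = head_perm w2 /\ head_tail w1 = head_tail w2.
Proof.
move=> eq12; rewrite -[w1]cats0 -[w2]cats0; move: (Nil _) => w.
have cong (u v v' : seq 'I_m) :
    head_perm v = head_perm v' /\ head_tail v = head_tail v' ->
    head_perm (u ++ v) = head_perm (u ++ v') /\ head_tail (u ++ v) = head_tail (u ++ v').
  by move=> eqv; elim: u => //= i u [-> ->].
have braid (v v' : seq 'I_m) : pos_eq v v' -> reduced v ->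
    forall w, head_perm (v ++ w) = head_perm (v' ++ w) /\
      head_tail (v ++ w) = head_tail (v' ++ w).
  move=> eqv rv w'; have rv' : reduced v' by rewrite -(pos_eq_reduced eqv).
  have [-> ->] := head_cat_reduced w' rv.
  by have [-> ->] := head_cat_reduced w' rv'; rewrite (pos_eq_perm eqv).
elim: eq12 w => {w1 w2}
  [//|v v' _ IH w|v2 v1 v3 _ IH1 _ IH2 w|v v' u u' _ IHv _ IHu w|i j far w|i j near w].
- by have [-> ->] := IH w.
- by have [-> ->] := IH1 w.
- by rewrite -!catA; have [-> ->] := IHv (u ++ w); apply: cong.
- exact: braid (pos_eq_far far) (reduced_far far) w.
- exact: braid (pos_eq_near near) (reduced_near near) w.
Qed.

(** The longest permutation absorbs nothing of a head, so head_tail recovers z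
    from Delta * z. *)
Lemma top_cancel (p q : bmonoid m) : pbraid (top m) * p = pbraid (top m) * q -> p = q.
Proof.
have tailE u : head_tail (word_of (top m) ++ u) = cl u.
  have [_ ->] := head_cat_reduced u (reduced_word (top m)).
  by rewrite perm_word rest_top -cl_head_tail.
rewrite -[p]cl_repr -[q]cl_repr -!cl_cat => /cl_eq/head_pos_eq[_].
by rewrite !tailE.
Qed.

End Head.

(** * The positive monoid embeds in the braid group *)
Section Embedding.
Variable m : nat.
Implicit Types (i j : 'I_m) (x y z a b c e v : 'S_m.+1) (w : seq 'I_m).

Local Notation D := (pbraid (top m)).

Lemma top_genr i : pbraid (top m * adj i) * gen i = D.
Proof.
have topE : top m * adj i * adj i = top m by rewrite -mulgA adjK mulg1.
by rewrite -pbraid_adj -pbraid_mul topE // wle_top.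
Qed.

Lemma top_genl i : gen (rev_ord i) * pbraid (top m * adj i) = D.
Proof.
have := adj_conj_top (rev_ord i); rewrite rev_ordK => <-.
have topE : adj (rev_ord i) * (adj (rev_ord i) * top m) = top m.
  by rewrite mulgA adjK mul1g.
by rewrite -pbraid_adj -pbraid_mul topE // wle_top.
Qed.

Lemma top_gen i : D * gen i = gen (rev_ord i) * D.
Proof. by rewrite -{1}(top_genl i) -mulgA top_genr. Qed.

(** Conjugation by Delta maps gen i to gen (rev_ord i), and rev_ord is an
    involution. *)
Lemma central_gen i : D * D * gen i = gen i * (D * D).
Proof. by rewrite -mulgA top_gen mulgA top_gen rev_ordK -mulgA. Qed.

Lemma central (p : bmonoid m) : commute (D * D) p.
Proof.
rewrite -[p]cl_repr; elim: (generic_quotient.repr p) => [|i w IH].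
  by rewrite cl_nil /commute mulg1 mul1g.
by rewrite cl_cons /commute mulgA central_gen -mulgA IH mulgA.
Qed.

(** Clearing denominators: the inverse of a generator is replaced by its product
    with Delta ^+ 2, which is positive.  So a word w stands for the fraction
    (denom w)^-1 * numer w. *)
Definition letter (l : 'I_m * bool) : bmonoid m :=
  if l.2 then D * pbraid (top m * adj l.1) else gen l.1.

Definition numer (w : braid_word m.+1) : bmonoid m :=
  \prod_(l <- w) letter l.
Definition denom (w : braid_word m.+1) : bmonoid m :=
  (D * D) ^+ count snd w.

Lemma numer_cat (v w : braid_word m.+1) : numer (v ++ w) = numer v * numer w.
Proof. exact: big_cat. Qed.

Lemma denom_cat (v w : braid_word m.+1) : denom (v ++ w) = denom v * denom w.
Proof. by rewrite /denom count_cat expgnDr. Qed.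

Lemma commute_denom (w : braid_word m.+1) p : denom w * p = p * denom w.
Proof. exact/commute_sym/commuteX/commute_sym/central. Qed.

Lemma denomCA (w : braid_word m.+1) p q : denom w * (p * q) = p * (denom w * q).
Proof. by rewrite mulgA (commute_denom w p) mulgA. Qed.

Lemma denom_cancel (w : braid_word m.+1) p q : denom w * p = denom w * q -> p = q.
Proof.
rewrite /denom; elim: (count _ _) => [|k IH]; first by rewrite expg0 !mul1g.
by rewrite expgS -!mulgA => /top_cancel/top_cancel.
Qed.

Definition pos_word w : braid_word m.+1 := [seq (i, false) | i <- w].

Lemma numer_pos w : numer (pos_word w) = cl w.
Proof.
elim: w => [|i w IH]; first by rewrite /numer big_nil cl_nil.
by rewrite cl_cons -IH /numer /= big_cons.
Qed.

Lemma denom_pos w : denom (pos_word w) = 1.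
Proof. by rewrite /denom count_map (eq_count (a2 := pred0)) // count_pred0. Qed.

(** Equality of fractions is an equivalence and a congruence because the
    denominators are central and cancellable; it remains to check the defining
    relations of the group. *)
Lemma braid_eq_frac (v w : braid_word m.+1) :
  braid_eq v w -> denom w * numer v = denom v * numer w.
Proof.
elim=> {v w} [//|v w _ -> //|v w x _ vw _ wx|v v' w w' _ vv' _ ww'|i e|i j far|i j near].
- apply: (@denom_cancel w); rewrite (denomCA w) vw (denomCA x) wx.
  exact: denomCA.
- rewrite !denom_cat !numer_cat -!mulgA (denomCA w') ww' (mulgA (denom v')) vv' -mulgA.
  by congr (_ * _); rewrite -denomCA.
- rewrite /denom /numer !big_cons !big_nil /= mulg1 mul1g.
  case: e => /=; rewrite /letter /= ?expg1.
    by rewrite mulg1 -mulgA top_genr.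
  by rewrite mulg1 mulgA -{1}[i]rev_ordK -top_gen -mulgA top_genl.
- rewrite (denom_pos [:: i; j]) (denom_pos [:: j; i]) !mul1g.
  by rewrite (numer_pos [:: i; j]) (numer_pos [:: j; i]); apply/cl_eq/pos_eq_far.
- rewrite (denom_pos [:: i; j; i]) (denom_pos [:: j; i; j]) !mul1g.
  rewrite (numer_pos [:: i; j; i]) (numer_pos [:: j; i; j]).
  exact/cl_eq/pos_eq_near.
Qed.

Definition br w : braid m.+1 := braid_of_word (pos_word w).

Lemma br_cat w1 w2 : br (w1 ++ w2) = br w1 * br w2.
Proof. by rewrite /br /pos_word map_cat -braid_mulE. Qed.

Lemma br_nil : br [::] = 1. Proof. by []. Qed.

Lemma br_cons i w : br (i :: w) = @sigma m.+1 i * br w.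
Proof. by rewrite -cat1s br_cat. Qed.

Lemma brE w : br w = \prod_(i <- w) @sigma m.+1 i.
Proof. by elim: w => [|i w IH]; rewrite ?big_nil ?big_cons ?br_cons ?IH. Qed.

Lemma pos_eq_br w1 w2 : pos_eq w1 w2 -> br w1 = br w2.
Proof.
elim=> {w1 w2} [//|v w _ -> //|v w x _ -> _ -> //|v v' w w' _ vv' _ ww'|i j far|i j near].
- by rewrite !br_cat vv' ww'.
- by apply/braid_of_wordP; exact: braid_eq_far.
- by apply/braid_of_wordP; exact: braid_eq_near.
Qed.

(** Positive words are fractions with denominator 1. *)
Lemma br_inj w1 w2 : br w1 = br w2 -> pos_eq w1 w2.
Proof.
by move=> /braid_of_wordP/braid_eq_frac; rewrite !numer_pos !denom_pos !mul1g => /cl_eq.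
Qed.

Lemma positiveP (x : braid m.+1) : positive x <-> exists w, x = br w.
Proof. by split=> -[w ->]; exists w; rewrite brE. Qed.

End Embedding.

(** * Simple braids as permutations *)
Section Simple.
Variable m : nat.
Implicit Types (i j : 'I_m) (a b c e v : 'S_m.+1) (w : seq 'I_m).
Implicit Types (x y z : braid m.+1).

Definition embed v : braid m.+1 := br (word_of v).

Lemma embed_perm w : reduced w -> embed (perm_of w) = br w.
Proof. by move=> rw; apply/pos_eq_br/cl_eq; exact: pbraid_perm. Qed.

Lemma embed_mul a b : a <=w a * b -> embed (a * b) = embed a * embed b.
Proof.
by move=> ab; rewrite -br_cat; apply/pos_eq_br/cl_eq; rewrite cl_cat; exact: pbraid_mul.
Qed.

(** The word spelled by Delta_upto. *)
Fixpoint delta_word k : seq 'I_m :=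
  if k is k'.+1 then [seq i : 'I_m <- index_enum _ | (i < k')%N] ++ delta_word k'
  else [::].

Lemma br_delta_word k : br (delta_word k) = Delta_upto m.+1 k.
Proof. by elim: k => //= k IH; rewrite br_cat IH brE big_filter. Qed.

Lemma count_lt n k : (k <= n)%N -> (\sum_(i < n | (i < k)%N) 1 = k)%N.
Proof. by move=> kn; rewrite -(big_ord_widen _ (fun=> 1%N)) // sum1_card card_ord. Qed.

Lemma size_delta_word k : (k <= m.+1)%N -> size (delta_word k) = (\sum_(l < k) l)%N.
Proof.
elim: k => [|k IH] km /=; first by rewrite big_ord0.
rewrite size_cat IH 1?ltnW // big_ord_recr addnC /=; congr (_ + _)%N.
by rewrite size_filter -sum1_count count_lt.
Qed.

Lemma len_top : len (top m) = (\sum_(l < m.+1) l)%N.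
Proof.
rewrite /len inversions_top -sum1dep_card.
rewrite -(pair_big_dep xpredT (fun k l : 'I_m.+1 => (k < l)%N) (fun _ _ => 1%N)) /=.
rewrite (exchange_big_dep xpredT) //=.
by apply: eq_bigr => l _; rewrite count_lt // ltnW.
Qed.

Lemma row_perm_val k (j : 'I_m.+1) : (k <= m)%N ->
  (\prod_(i < m | (i < k)%N) adj i) j =
    (if j == 0%N :> nat then k else if (j <= k)%N then j.-1 else j) :> nat.
Proof.
elim: k => [|k IH] km.
  by rewrite big_pred0 // perm1; case: ltngtP.
rewrite big_ord_narrow // big_ord_recr /= permM adj_val /=.
have -> : \prod_(i < k) adj (widen_ord km (widen_ord (leqnSn k) i)) =
          \prod_(i < m | (i < k)%N) adj i.
  rewrite (big_ord_narrow (ltnW km)); apply: eq_bigr => i _.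
  by congr adj; exact: val_inj.
rewrite (IH (ltnW km)) {IH}; move: (nat_of_ord j) => d.
have [_|d0] := posnP d; first by rewrite eqxx.
case: (leqP d k) => dk; case: (leqP d k.+1) => dk'; do 2?[case: eqP => ?]; lia.
Qed.

Lemma delta_perm_val k (j : 'I_m.+1) : (k <= m.+1)%N ->
  perm_of (delta_word k) j = (if (j < k)%N then k.-1 - j else j)%N :> nat.
Proof.
elim: k j => [|k IH] j km /=; first by rewrite perm_of_nil perm1.
rewrite perm_of_cat permM (IH _ (ltnW km)) /perm_of big_filter row_perm_val //.
case: eqP => [->|j0]; first by rewrite ltnn subn0.
case: (leqP j k) => jk; last by rewrite !ifF //; lia.
by rewrite !ifT; lia.
Qed.

Lemma delta_word_top : perm_of (delta_word m.+1) = top m.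
Proof.
apply/permP=> j; apply: val_inj; apply: (etrans (delta_perm_val j (leqnn _))).
by rewrite ltn_ord /= top_val.
Qed.

(** The word of Delta represents top and has as many letters as top has
    inversions, so it is reduced. *)
Lemma Delta_embed : Delta m.+1 = embed (top m).
Proof.
rewrite -delta_word_top embed_perm ?br_delta_word //.
by rewrite /reduced delta_word_top len_top size_delta_word.
Qed.

Lemma embed_br_cat v w1 w2 : embed v = br (w1 ++ w2) ->
  reduced (w1 ++ w2) /\ perm_of (w1 ++ w2) = v.
Proof.
move=> /br_inj eqv; rewrite -(pos_eq_reduced eqv) reduced_word.
by rewrite -(pos_eq_perm eqv) perm_word.
Qed.

(** A left divisor of Delta is the braid of a prefix of a reduced word, hence of
    a reduced word. *)
Lemma simpleP x : simple x <-> exists v, x = embed v.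
Proof.
split=> [[/positiveP[w1 ->] _ [_ /positiveP[w2 ->]]]|[v ->]].
  rewrite -br_cat Delta_embed => /embed_br_cat[/reduced_cat/andP[r1 _] _].
  by exists (perm_of w1); rewrite embed_perm.
split; try by apply/positiveP; eexists.
  by rewrite Delta_embed; apply/positiveP; eexists.
exists (embed (v^-1 * top m)); first by apply/positiveP; eexists.
by rewrite -embed_mul ?mulKVg ?wle_top -?Delta_embed.
Qed.

Lemma positive_mul x y : positive x -> positive y -> positive (x * y).
Proof.
by move=> /positiveP[v ->] /positiveP[w ->]; rewrite -br_cat; apply/positiveP; eexists.
Qed.

(** Left divisibility, as a left-invariant order on the whole group. *)
Definition dvl x y : Prop := positive (x^-1 * y).
Local Notation "x <=L y" := (dvl x y) (at level 70).

Lemma positive_br w : positive (br w). Proof. by apply/positiveP; exists w. Qed.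

Lemma embed_le a b : embed a <=L embed b <-> a <=w b.
Proof.
split=> [ab|ab]; last first.
  rewrite /dvl -{1}(mulKVg a b) embed_mul ?mulKVg // mulKg; exact: positive_br.
have /positiveP[w e] := ab; have : embed b = br (word_of a ++ w).
  by rewrite br_cat -e mulKVg.
move/embed_br_cat=> [/reduced_cat_wle]; rewrite perm_word => le <-; exact: le.
Qed.

Lemma embed_head w : embed (head_perm w) <=L br w.
Proof.
have /cl_eq/pos_eq_br -> :
    cl w = cl (word_of (head_perm w) ++ generic_quotient.repr (head_tail w)).
  by rewrite cl_cat cl_repr -cl_head_tail.
by rewrite /dvl br_cat mulKg; exact: positive_br.
Qed.

Lemma le_head v w : embed v <=L br w -> v <=w head_perm w.
Proof.
move=> /positiveP[u e]; have /br_inj/head_pos_eq[-> _] : br w = br (word_of v ++ u).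
  by rewrite br_cat -e mulKVg.
have [-> _] := head_cat_reduced u (reduced_word v); rewrite perm_word; exact: wle_act.
Qed.

Lemma dvl_trans y x z : x <=L y -> y <=L z -> x <=L z.
Proof. by move=> xy yz; rewrite /dvl -(mulKVg y z) mulgA; exact: positive_mul. Qed.

(** The embedding of the weak order sends the meet of the heads of z1 and z2 to
    the required braid.  With z1 = z2 this is the existence of a greatest simple
    left divisor. *)
Lemma simple_gcd z1 z2 : positive z1 -> positive z2 ->
  exists h, [/\ simple h, h <=L z1, h <=L z2 &
    forall x, simple x -> x <=L z1 -> x <=L z2 -> x <=L h].
Proof.
move=> /positiveP[w1 ->] /positiveP[w2 ->].
exists (embed (meet (head_perm w1) (head_perm w2))); split.
- by apply/simpleP; eexists.
- by apply: dvl_trans (embed_head w1); apply/embed_le/meetl.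
- by apply: dvl_trans (embed_head w2); apply/embed_le/meetr.
by move=> _ /simpleP[v ->] /le_head v1 /le_head v2; apply/embed_le/le_meet.
Qed.

Lemma positive_anti x : positive x -> positive x^-1 -> x = 1.
Proof.
move=> /positiveP[v xv] /positiveP[w xw].
have /br_inj/pos_eq_size : br (v ++ w) = br [::] by rewrite br_cat -xv -xw mulgV.
by rewrite size_cat xv; case: v {xv} => // _; rewrite br_nil.
Qed.

Lemma sigma_neq1 i : @sigma m.+1 i <> 1.
Proof. by move=> e; have /br_inj/pos_eq_size : br [:: i] = br [::] by []. Qed.

Lemma ex_sigma x : positive x -> x <> 1 -> exists i : 'I_m, @sigma m.+1 i <=L x.
Proof.
move=> /positiveP[[|i w] ->] // _; exists i.
by rewrite /dvl br_cons mulKg; exact: positive_br.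
Qed.

Lemma size_word v : size (word_of v) = len v.
Proof. by rewrite -(eqP (reduced_word v)) perm_word. Qed.

(** For the permutation v of x, multiplying by adj i on the right changes the
    length by one: down if i is a descent of v^-1, that is if some reduced word
    of v ends with i, and up otherwise. *)
Lemma simple_sigma i x : simple x ->
  simple (x * @sigma m.+1 i) <-> ~ right_divisor (@sigma m.+1 i) x.
Proof.
move=> /simpleP[v ->].
have br1 : @sigma m.+1 i = br [:: i] by [].
have desc_len : descent i v^-1 -> len v = (len (v * adj i)).+1.
  by move/len_desc; rewrite lenV -[v * _]invgK lenV invMg adjV.
have asc_len : ~~ descent i v^-1 -> len (v * adj i) = (len v).+1.
  by move/len_asc; rewrite lenV -[v * _]invgK lenV invMg adjV.
have pE w : perm_of (w ++ [:: i]) = perm_of w * adj i.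
  by rewrite perm_of_cat perm_of_cons perm_of_nil mulg1.
case: (boolP (descent i v^-1)) => d.
  split=> [/simpleP[v']|nd].
    rewrite br1 -br_cat => /esym/embed_br_cat[/eqP + _].
    by rewrite pE perm_word size_cat size_word desc_len //; lia.
  case: nd; rewrite br1; split; [exact: positive_br | exact: positive_br |].
  exists (embed (v * adj i)); first exact: positive_br.
  rewrite -br_cat -embed_perm; rewrite ?/reduced pE perm_word -mulgA adjK mulg1 //.
  by rewrite size_cat size_word addn1 desc_len.
split=> [_ [_ _ [_ /positiveP[w ->]]]|_].
  rewrite br1 -br_cat => /embed_br_cat[/eqP r vE].
  have := asc_len d; rewrite -vE r pE -mulgA adjK mulg1 size_cat addn1.
  by have := len_perm_of w; lia.
apply/simpleP; exists (v * adj i).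
rewrite br1 -br_cat -{2}(perm_word v) -pE embed_perm //.
by rewrite /reduced pE perm_word asc_len // size_cat size_word addn1.
Qed.

Lemma br_Delta w : br w * Delta m.+1 = Delta m.+1 * br [seq rev_ord i | i <- w].
Proof.
rewrite Delta_embed /embed; elim: w => [|i w IH]; first by rewrite !br_nil mul1g mulg1.
have /cl_eq/pos_eq_br swap :
    cl (i :: word_of (top m)) = cl (word_of (top m) ++ [:: rev_ord i]).
  by rewrite cl_cons cl_cat -[in LHS](rev_ordK i) -top_gen.
rewrite (br_cons i w) -mulgA IH mulgA -(br_cons i) swap br_cat /= !br_cons br_nil mulg1.
by rewrite -!mulgA.
Qed.

Lemma positive_conj x : positive x -> positive (x ^ Delta m.+1).
Proof.
by move=> /positiveP[w ->]; rewrite conjgE br_Delta mulKg; exact: positive_br.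
Qed.

Lemma positive_conjV x : positive x -> positive (x ^ (Delta m.+1)^-1).
Proof.
move=> /positiveP[w ->]; apply/positiveP; exists [seq rev_ord i | i <- w].
by rewrite -[w in LHS](mapK (@rev_ordK m)) conjgE invgK mulgA -br_Delta mulgK.
Qed.

End Simple.

Notation "x <=L y" := (dvl x y) (at level 70).

(** * Left divisibility in the group and normality as coprimeness *)
Section Normal.
Variable m : nat.
Implicit Types (a b c d e h s t u v x y z : braid m.+1) (r : seq (braid m.+1)).
Local Notation D := (Delta m.+1).

Lemma positive1 : positive (1 : braid m.+1).
Proof. by exists [::]; rewrite big_nil. Qed.

Lemma dvl_refl x : x <=L x.
Proof. by rewrite /dvl mulVg; exact: positive1. Qed.

Lemma dvl_mul2l a x y : (a * x <=L a * y) = (x <=L y).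
Proof. by rewrite /dvl invMg -mulgA mulKg. Qed.

Lemma dvl_mulV a x y : (a * x <=L y) = (x <=L a^-1 * y).
Proof. by rewrite -{1}(mulKVg a y) dvl_mul2l. Qed.

Lemma dvl_mulr x y : positive y -> x <=L x * y.
Proof. by rewrite /dvl mulKg. Qed.

Lemma dvl1_eq x : positive x -> x <=L 1 -> x = 1.
Proof. by rewrite /dvl mulg1; exact: positive_anti. Qed.

Lemma left_divisorE x y : left_divisor x y <-> positive x /\ x <=L y.
Proof.
split=> [[px _ [z pz ->]]|[px xy]]; first by split=> //; exact: dvl_mulr.
split=> //; first by rewrite -(mulKVg x y); exact: positive_mul.
by exists (x^-1 * y); rewrite ?mulKVg.
Qed.

Lemma simple_pos x : simple x -> positive x. Proof. by case. Qed.
Lemma simple_le x : simple x -> x <=L D. Proof. by case/left_divisorE. Qed.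
Lemma simpleI x : positive x -> x <=L D -> simple x.
Proof. by move=> px xD; apply/left_divisorE. Qed.

Lemma simple1 : simple (1 : braid m.+1).
Proof.
apply: simpleI positive1 _; rewrite /dvl invg1 mul1g Delta_embed; exact: positive_br.
Qed.

Lemma simple_r a b : positive a -> positive b -> simple (a * b) -> simple b.
Proof.
move=> pa pb sab; apply: simpleI => //.
(* Stated for a variable d: rewriting would unfold Delta. *)
have genE d : b^-1 * d = (a * b)^-1 * d * a ^ d.
  by rewrite conjgE invMg !mulgA mulgK mulgKV.
by rewrite /dvl genE; apply: positive_mul (simple_le sab) (positive_conj pa).
Qed.

Lemma simple_Delta : simple D.
Proof. by apply: simpleI (dvl_refl _); rewrite Delta_embed; exact: positive_br. Qed.

Lemma simple_rstar s : simple s -> simple (rstar s).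
Proof.
move=> ss; apply: (@simple_r s); [exact: simple_pos | exact: simple_le |].
by rewrite mulKVg; exact: simple_Delta.
Qed.

(** Conjugation by Delta preserves positivity both ways, hence all the notions
    defined from it; it relates the two complements lstar and rstar. *)
Definition tau x : braid m.+1 := x ^ D^-1.

Lemma positive_tau x : positive (tau x) <-> positive x.
Proof.
by split=> [/positive_conj|]; [rewrite /tau conjgKV | exact: positive_conjV].
Qed.

Lemma dvl_tau x y : tau x <=L tau y <-> x <=L y.
Proof. by rewrite /dvl -conjVg -conjMg; exact: positive_tau. Qed.

Lemma tau_Delta : tau D = D.
Proof.
have genE d : d ^ d^-1 = d by rewrite conjgE invgK mulgV mulg1.
exact: genE.
Qed.

Lemma simple_tau x : simple (tau x) <-> simple x.
Proof.
split=> [sx|sx]; apply: simpleI; have [px xD] := (simple_pos sx, simple_le sx).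
- exact/positive_tau.
- by apply/dvl_tau; rewrite tau_Delta.
- exact/positive_tau.
- by rewrite -tau_Delta; apply/dvl_tau.
Qed.

Lemma lstarE s : lstar s = tau (rstar s).
Proof.
have genE d : d * s^-1 = (s^-1 * d) ^ d^-1 by rewrite conjgE invgK -!mulgA mulgV mulg1.
exact: genE.
Qed.

Lemma tau_rstar_rstar s : tau (rstar (rstar s)) = s.
Proof.
have genE d : ((s^-1 * d)^-1 * d) ^ d^-1 = s.
  by rewrite conjgE invMg !invgK !mulgA mulgV mul1g mulgK.
exact: genE.
Qed.

Lemma simple_lstar s : simple s -> simple (lstar s).
Proof. by rewrite lstarE => ss; apply/simple_tau/simple_rstar. Qed.

(** For positive a and b this says gcd_L(a, b) = 1, see [is_gcdL1]. *)
Definition coprimeL a b := forall x, positive x -> x <=L a -> x <=L b -> x = 1.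

Lemma coprimeL_sym a b : coprimeL a b -> coprimeL b a.
Proof. by move=> ab x px xb xa; exact: ab. Qed.

Lemma coprimeL1 a : coprimeL a 1.
Proof. by move=> x px _; exact: dvl1_eq. Qed.

Lemma coprimeL_tau a b : coprimeL (tau a) (tau b) <-> coprimeL a b.
Proof.
split=> cp x px.
  move=> /dvl_tau xa /dvl_tau xb; move/positive_tau: px => px.
  by apply: (conjg_inj D^-1); rewrite conj1g; exact: cp.
have -> : x = tau (x ^ D) by rewrite /tau conjgK.
move=> /dvl_tau xa /dvl_tau xb.
by rewrite (cp _ (positive_conj px) xa xb) /tau conj1g.
Qed.

Lemma is_gcdL1 a b : positive a -> positive b -> is_gcdL a b 1 <-> coprimeL a b.
Proof.
move=> pa pb; split=> [[_ _ gcd] x px xa xb|cp].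
  have /left_divisorE[_] : left_divisor x 1 by apply: gcd; apply/left_divisorE.
  exact: dvl1_eq.
have le1 c : positive c -> left_divisor 1 c.
  by move=> pc; apply/left_divisorE; split; [exact: positive1 | rewrite /dvl invg1 mul1g].
split; [exact: le1 | exact: le1 |].
move=> x /left_divisorE[px xa] /left_divisorE[_ xb]; rewrite (cp x px xa xb).
exact/le1/positive1.
Qed.

(** A generator divides rstar a iff its product with a is simple, that is iff it
    is not a right divisor of a.  So the left-hand side says that no generator
    divides both rstar a and b, and every nontrivial positive braid is divisible
    by a generator. *)
Lemma coprimeL_sigma a b : simple a ->
  (forall i : 'I_m, left_divisor (@sigma m.+1 i) b -> right_divisor (@sigma m.+1 i) a) <->
  coprimeL (rstar a) b.
Proof.
have posE i : positive (@sigma m.+1 i) by exists [:: i]; rewrite big_seq1.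
move=> sa; have simE i : simple (a * @sigma m.+1 i) <-> @sigma m.+1 i <=L rstar a.
  rewrite -dvl_mulV; split=> [/simple_le //|le]; apply: simpleI => //.
  by apply: positive_mul => //; exact: simple_pos.
split=> [div x px xa xb|cp i /left_divisorE[pi ib]].
  apply: contrapT => /(ex_sigma px)[i ix].
  have /(simple_sigma i sa) : simple (a * @sigma m.+1 i) by apply/simE/(dvl_trans ix).
  apply; apply: div; apply/left_divisorE; split=> //; exact: dvl_trans xb.
apply: contrapT => /(simple_sigma i sa)/simE ia.
exact: sigma_neq1 (cp _ pi ia ib).
Qed.

(** Coprimeness with 1 is no condition, so the default value of head makes the
    case of an empty tail uniform. *)
Lemma normal_cons a r :
  normal (a :: r) <-> [/\ simple a, normal r & coprimeL (rstar a) (head 1 r)].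
Proof.
split=> [[sim loc]|[sa [sim loc] cp]].
  have sa : simple a by apply: sim; rewrite mem_head.
  split=> //; first split=> [s sr|k kr i].
  - by apply: sim; rewrite inE sr orbT.
  - exact: (loc k.+1 kr i).
  case: r loc {sim} => [|b r] loc; first exact: coprimeL1.
  by apply/(coprimeL_sigma _ sa) => i; exact: (loc 0%N).
split=> [s|[|k] kr i]; first by rewrite inE => /predU1P[->|/sim].
  by case: r cp {sim loc} kr => // b r /(coprimeL_sigma _ sa) + _; apply.
exact: loc.
Qed.

Lemma normal_nil : normal (Nil (braid m.+1)). Proof. by []. Qed.

Lemma normal_head r : normal r -> simple (head 1 r).
Proof. by case: r => [|a r] ; [move=> _; exact: simple1 | case/normal_cons]. Qed.

End Normal.

(** * The defining pairs and the domino rules *)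
Section Domino.
Variable m : nat.
Implicit Types (a b c d e h s t u v w x y z : braid m.+1) (r : seq (braid m.+1)).

Lemma simple_dvl_quot a h : simple h -> positive a -> a <=L h -> simple (a^-1 * h).
Proof. by move=> sh pa ah; apply: (@simple_r _ a) => //; rewrite mulKVg. Qed.

(** Let h be the greatest simple left divisor of a * b.  Then a^-1 * h divides
    both rstar a, as h is simple, and b. *)
Lemma greedy_dvl a b x : simple a -> positive b -> coprimeL (rstar a) b ->
  simple x -> x <=L a * b -> x <=L a.
Proof.
move=> sa pb cp sx xab; have pab := positive_mul (simple_pos sa) pb.
have [h [sh hab _ hmax]] := simple_gcd pab pab.
have ah : a <=L h by apply: hmax => //; exact: dvl_mulr.
have /mulg1_eq aE : a^-1 * h = 1.
  apply: cp => //; rewrite -(dvl_mul2l a) !mulKVg //; exact: simple_le.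
by rewrite -(invgK a) aE; exact: hmax.
Qed.

(** Let h be the greatest simple left divisor of u * a * b.  It is divisible by
    u, and u^-1 * h is a simple divisor of a * b, hence of a. *)
Lemma greedy_dvl_mull u a b x : simple u -> simple a -> positive b ->
  coprimeL (rstar a) b -> simple x -> x <=L u * (a * b) -> x <=L u * a.
Proof.
move=> su sa pb cp sx xuab; have pab := positive_mul (simple_pos sa) pb.
have puab := positive_mul (simple_pos su) pab.
have [h [sh huab _ hmax]] := simple_gcd puab puab.
have uh : u <=L h by apply: hmax => //; exact: dvl_mulr.
apply: dvl_trans (hmax x sx xuab xuab) _.
rewrite -[h](mulKVg u) dvl_mul2l; apply: (greedy_dvl sa pb cp).
  exact: simple_dvl_quot (simple_pos su) uh.
by rewrite -(dvl_mul2l u) mulKVg.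
Qed.

Lemma simple_mul_le a x : simple a -> positive x -> x <=L rstar a -> simple (a * x).
Proof.
move=> sa px xa; apply: simpleI; last by rewrite dvl_mulV.
exact: positive_mul (simple_pos sa) px.
Qed.

(** If x divides rstar t1' and t2', then t1' * x is a simple divisor of
    v0 * t1 * t2, hence of v0 * t1 = t1' * v1: x divides v1 as well. *)
Lemma dominoL v0 t1 t2 t1' v1 t2' v2 :
  simple v0 -> simple t1 -> simple t2 -> simple t1' -> positive v2 ->
  v0 * t1 = t1' * v1 -> v1 * t2 = t2' * v2 ->
  coprimeL (rstar t1) t2 -> coprimeL (rstar t1') v1 ->
  coprimeL (rstar t1') t2'.
Proof.
move=> sv0 st1 st2 st1' pv2 e1 e2 cp cp' x px xt1 xt2; apply: cp' => //.
rewrite -(mulKg t1' v1) -e1 -dvl_mulV; apply: (greedy_dvl_mull sv0 st1 (simple_pos st2) cp).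
  exact: simple_mul_le.
rewrite mulgA e1 -mulgA e2 dvl_mul2l; exact: dvl_trans xt2 (dvl_mulr _ pv2).
Qed.

(** As for [dominoL]: a common divisor of rstar e1 and e2 divides u1 as well, and
    here u1 is coprime to e2. *)
Lemma dominoR u0 s1 s2 e1 u1 e2 u2 :
  simple u0 -> simple s1 -> simple s2 -> simple e1 -> positive u2 ->
  u0 * s1 = e1 * u1 -> u1 * s2 = e2 * u2 ->
  coprimeL (rstar s1) s2 -> coprimeL e2 u1 ->
  coprimeL (rstar e1) e2.
Proof.
move=> su0 ss1 ss2 se1 pu2 eq1 eq2 cp cp' x px xe1 xe2; apply: cp' => //.
rewrite -(mulKg e1 u1) -eq1 -dvl_mulV; apply: (greedy_dvl_mull su0 ss1 (simple_pos ss2) cp).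
  exact: simple_mul_le.
rewrite mulgA eq1 -mulgA eq2 dvl_mul2l; exact: dvl_trans xe2 (dvl_mulr _ pu2).
Qed.

(** As s1 and t1 are coprime, u0 is the greatest simple common divisor of
    u0 * s1 and u0 * t1; so a common divisor of e1 and t1' divides u0. *)
Lemma coprimeL_cross u0 s1 t1 e1 u1 t1' v1 :
  simple u0 -> positive s1 -> positive t1 -> simple e1 -> positive u1 -> positive v1 ->
  u0 * s1 = e1 * u1 -> u0 * t1 = t1' * v1 ->
  coprimeL s1 t1 -> coprimeL e1 u0 -> coprimeL e1 t1'.
Proof.
move=> su0 ps1 pt1 se1 pu1 pv1 eqs eqt cp cp' x px xe xt; apply: cp' => //.
have [h [sh hs ht hmax]] :=
  simple_gcd (positive_mul (simple_pos su0) ps1) (positive_mul (simple_pos su0) pt1).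
have uh : u0 <=L h by apply: hmax => //; exact: dvl_mulr.
have /mulg1_eq aE : u0^-1 * h = 1.
  by apply: cp => //; rewrite -(dvl_mul2l u0) mulKVg.
rewrite -[u0]invgK aE; apply: hmax; first exact: simpleI (dvl_trans xe (simple_le se1)).
  by rewrite eqs; exact: dvl_trans xe (dvl_mulr _ pu1).
by rewrite eqt; exact: dvl_trans xt (dvl_mulr _ pv1).
Qed.

Lemma normal2 a b :
  normal [:: a; b] <-> [/\ simple a, simple b & coprimeL (rstar a) b].
Proof.
rewrite normal_cons /=; split=> [[sa /normal_cons[sb _ _] cp]|[sa sb cp]] //.
by split=> //; apply/normal_cons; split=> //; exact: coprimeL1.
Qed.

(** Such a pair exists: take the greatest simple left divisor of a * b and its
    cofactor, which is simple as a right divisor of b. *)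
Lemma normal_pairP a b c d : simple a -> simple b -> (c, d) = normal_pair (a * b) ->
  [/\ simple c, simple d, a * b = c * d & coprimeL (rstar c) d].
Proof.
move=> sa sb cd; have pab := positive_mul (simple_pos sa) (simple_pos sb).
have [h [sh hab _ hmax]] := simple_gcd pab pab.
have ah : a <=L h by apply: hmax => //; exact/dvl_mulr/simple_pos.
have cp : coprimeL (rstar h) (h^-1 * (a * b)).
  move=> x px xh xab; apply: (positive_anti px).
  have := hmax (h * x) (simple_mul_le sh px xh); rewrite !dvl_mulV => /(_ xab xab).
  by rewrite mulVg /dvl mulg1.
have sq : simple (h^-1 * (a * b)).
  by apply: (@simple_r _ (a^-1 * h)) => //; rewrite -mulgA mulKVg mulKg.
have : [set ab : braid m.+1 * braid m.+1 |
    [/\ simple ab.1, simple ab.2, a * b = ab.1 * ab.2 & normal [:: ab.1; ab.2]]]%classic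
    (normal_pair (a * b)).
  apply: (@xgetPex _ (1, 1)); exists (h, h^-1 * (a * b)); split=> //=.
    by rewrite mulKVg.
  exact/normal2.
by rewrite -cd => -[sc sd e /normal2[_ _ cp']].
Qed.

(** The equation says that b^-1 * a is the fraction (lstar s)^-1 * lstar t; its
    reduced form is obtained by cancelling the greatest common left divisor of
    lstar s and lstar t. *)
Lemma coprime_pairP s t a b : simple s -> simple t -> (a, b) = coprime_pair s t ->
  [/\ simple a, simple b, a * t = b * s & coprimeL a b].
Proof.
move=> ss st ab; have [sA sB] := (simple_lstar ss, simple_lstar st).
have [h [sh hA hB hmax]] := simple_gcd (simple_pos sA) (simple_pos sB).
have sa := simple_dvl_quot sB (simple_pos sh) hB.
have sb := simple_dvl_quot sA (simple_pos sh) hA.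
have cp : coprimeL (h^-1 * lstar t) (h^-1 * lstar s).
  move=> x px; rewrite -!dvl_mulV => xB xA; apply: (positive_anti px).
  have : h * x <=L h.
    apply: hmax => //; apply: simpleI (dvl_trans xA (simple_le sA)).
    exact: positive_mul (simple_pos sh) px.
  by rewrite dvl_mulV mulVg /dvl mulg1.
have : [set ab : braid m.+1 * braid m.+1 |
    [/\ simple ab.1, simple ab.2, ab.1 * t = ab.2 * s & is_gcdL ab.1 ab.2 1]]%classic
    (coprime_pair s t).
  apply: (@xgetPex _ (1, 1)); exists (h^-1 * lstar t, h^-1 * lstar s); split=> //=.
    by rewrite /lstar -!mulgA !mulVg.
  by apply/is_gcdL1 => //; exact: simple_pos.
by rewrite -ab => -[/= ? ? ? /is_gcdL1-/(_ (simple_pos _) (simple_pos _))]; split; auto.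
Qed.

End Domino.

(** * Dividing a symmetric normal form by a simple braid *)
Section Pass.
Variable m : nat.
Implicit Types (s t u v x y z : braid m.+1) (r S T L R : seq (braid m.+1)).
Implicit Types (U V : nat -> braid m.+1).
Local Notation D := (Delta m.+1).

Lemma mkseqS (A : Type) (f : nat -> A) k :
  mkseq f k.+1 = f 0%N :: mkseq (fun j => f j.+1) k.
Proof. by rewrite /mkseq /= (iotaDl 1) -map_comp. Qed.

Lemma prod_pass T V V' :
  (forall j, (j < size T)%N -> V j * nth 1 T j = V' j * V j.+1) ->
  V 0%N * \prod_(x <- T) x = (\prod_(x <- mkseq V' (size T)) x) * V (size T).
Proof.
elim: T V V' => [|t T IH] V V' eqs; first by rewrite !big_nil mulg1 mul1g.
rewrite [size _]/= mkseqS !big_cons mulgA (eqs 0%N) // -!mulgA; congr (_ * _).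
by apply: (IH (fun j => V j.+1)) => j; exact: (eqs j.+1).
Qed.

Lemma normal_pass_left T V V' : normal T ->
  (forall j, (j <= size T)%N -> simple (V j)) ->
  (forall j, (j < size T)%N -> [/\ simple (V' j), V j * nth 1 T j = V' j * V j.+1 &
    coprimeL (rstar (V' j)) (V j.+1)]) ->
  normal (rcons (mkseq V' (size T)) (V (size T))).
Proof.
elim: T V V' => [|t T IH] V V' norT simV step.
  apply/normal_cons; split; [exact: simV | exact: normal_nil | exact: coprimeL1].
have [st norT1 cpt] := (normal_cons _ _).1 norT.
have [sT0 eq0 cp0] := step 0%N isT; rewrite /= in eq0.
rewrite [size _]/= mkseqS rcons_cons; apply/normal_cons; split=> //.
  by apply: (IH (fun j => V j.+1)) => // j; [exact: (simV j.+1) | exact: (step j.+1)].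
case: T norT1 cpt simV step {IH norT} => [|t2 T] norT1 cpt simV step //=.
have [sT1 eq1 cp1] := step 1%N isT.
apply: dominoL eq0 eq1 cpt cp0 => //; first exact: (simV 0%N).
  by case/normal_cons: norT1.
exact/simple_pos/(simV 2%N).
Qed.

Lemma normal_pass_right S U U' : normal S ->
  (forall j, (j <= size S)%N -> simple (U j)) ->
  (forall j, (j < size S)%N -> [/\ simple (U' j), U j * nth 1 S j = U' j * U j.+1 &
    coprimeL (U' j) (U j)]) ->
  normal (mkseq U' (size S)).
Proof.
elim: S U U' => [|s S IH] U U' norS simU step //.
have [ss norS1 cps] := (normal_cons _ _).1 norS.
have [sS0 eq0 cp0] := step 0%N isT; rewrite /= in eq0.
rewrite [size _]/= mkseqS; apply/normal_cons; split=> //.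
  by apply: (IH (fun j => U j.+1)) => // j; [exact: (simU j.+1) | exact: (step j.+1)].
case: S norS1 cps simU step {IH norS} => [|s2 S] norS1 cps simU step /=.
  exact: coprimeL1.
have [sS1 eq1 cp1] := step 1%N isT.
apply: dominoR eq0 eq1 cps cp1 => //; first exact: (simU 0%N).
  by case/normal_cons: norS1.
exact/simple_pos/(simU 2%N).
Qed.

(** The common core of both parts.  The simple braid U (size S) by which the
    fraction is divided moves to the left through the numerators S and leaves
    them as U 0; it is then multiplied into the denominators T from the left. *)
Lemma quotient_pass S T U V U' V' :
  normal S -> normal T -> coprimeL (head 1 S) (head 1 T) -> V 0%N = U 0%N ->
  (forall j, (j <= size S)%N -> simple (U j)) ->
  (forall j, (j <= size T)%N -> simple (V j)) ->
  (forall j, (j < size S)%N -> [/\ simple (U' j), U j * nth 1 S j = U' j * U j.+1 &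
    coprimeL (U' j) (U j)]) ->
  (forall j, (j < size T)%N -> [/\ simple (V' j), V j * nth 1 T j = V' j * V j.+1 &
    coprimeL (rstar (V' j)) (V j.+1)]) ->
  let L := rcons (mkseq V' (size T)) (V (size T)) in
  let R := mkseq U' (size S) in
  [/\ normal L, normal R, coprimeL (head 1 R) (head 1 L) &
    (\prod_(x <- T) x)^-1 * (\prod_(x <- S) x) * (U (size S))^-1 =
    (\prod_(x <- L) x)^-1 * (\prod_(x <- R) x)].
Proof.
move=> norS norT cp VU simU simV stepS stepT L R; split.
- exact: normal_pass_left.
- exact: normal_pass_right stepS.
- rewrite /L /R; case: S norS cp simU stepS {R} => [|s S] norS cp simU stepS.
    exact/coprimeL_sym/coprimeL1.
  have [sS0 /= eqS cpS] := stepS 0%N isT.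
  case: T norT cp simV stepT {L} => [|t T] norT cp simV stepT /=.
    by rewrite VU.
  have [sT0 /= eqT cpT] := stepT 0%N isT.
  have [] := (normal_head norS, normal_head norT) => /= ss st.
  rewrite VU in eqT; apply: coprimeL_cross eqS eqT cp cpS => //; try exact: simple_pos.
  - exact: (simU 0%N).
  - exact/simple_pos/(simU 1%N).
  - exact/simple_pos/(simV 1%N).
have eqS : U 0%N * \prod_(x <- S) x = (\prod_(x <- R) x) * U (size S).
  by apply: prod_pass => j /stepS[].
have eqT : V 0%N * \prod_(x <- T) x = \prod_(x <- L) x.
  rewrite /L -cats1 big_cat big_seq1; apply: prod_pass => j /stepT[] //.
rewrite -eqT invMg VU -!mulgA; congr (_ * _); apply: (mulgI (U 0%N)).
by rewrite mulKVg mulgA eqS mulgK.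
Qed.

Lemma trimP r : exists k, r = trim r ++ nseq k 1.
Proof.
exists (find (predC1 1) (rev r)); rewrite /trim.
set k := find _ _; rewrite -[r in LHS]revK -{1}(cat_take_drop k (rev r)) rev_cat.
congr (_ ++ _); have -> : take k (rev r) = nseq k 1; last by rewrite rev_nseq.
apply: (@eq_from_nth _ 1) => [|j]; rewrite size_takel ?find_size ?size_nseq //.
move=> jk; rewrite nth_take // nth_nseq jk.
by apply/eqP; have /negbFE := before_find 1 jk.
Qed.

Lemma last_trim r : trim r <> [::] -> last 1 (trim r) <> 1.
Proof.
rewrite /trim; case E : (drop _ _) => [|x d] // _.
have kr : (find (predC1 (1%g : braid m.+1)) (rev r) < size (rev r))%N.
  by rewrite ltnNge; apply/negP => /drop_oversize; rewrite E.
move: E; rewrite (drop_nth 1 kr) => -[xE _]; rewrite rev_cons last_rcons -xE.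
have := nth_find 1 (a := predC1 (1 : braid m.+1)) (s := rev r).
by rewrite has_find => /(_ kr)/eqP.
Qed.

Lemma normal_prefix L R : normal (L ++ R) -> normal L.
Proof.
elim: L => [_|s L IH]; first exact: normal_nil.
rewrite cat_cons => /normal_cons[ss norLR cp]; apply/normal_cons; split=> //; first exact: IH.
by case: L cp {IH norLR} => [|s2 L] //= _; exact: coprimeL1.
Qed.

Lemma prodV_rev r : \prod_(x <- rev r) x^-1 = (\prod_(x <- r) x)^-1.
Proof.
elim: r => [|x r IH]; first by rewrite !big_nil invg1.
by rewrite rev_cons -cats1 big_cat big_seq1 big_cons invMg IH.
Qed.

Lemma snf_trim z L R : normal L -> normal R -> coprimeL (head 1 R) (head 1 L) ->
  z = (\prod_(x <- L) x)^-1 * (\prod_(x <- R) x) ->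
  symmetric_normal_form z (trim L) (trim R).
Proof.
move=> norL norR cp zE.
have prod1 k : \prod_(x <- nseq k (1 : braid m.+1)) x = 1.
  by elim: k => [|k IH]; rewrite ?big_nil //= big_cons IH mulg1.
have [[k Lk] [l Rl]] := (trimP L, trimP R).
split.
- by rewrite prodV_rev zE {1}Lk {1}Rl !big_cat !prod1 /= !mulg1.
- by move: norL; rewrite {1}Lk => /normal_prefix.
- by move: norR; rewrite {1}Rl => /normal_prefix.
- by split; exact: last_trim.
have head_trim r : trim r <> [::] -> head 1 (trim r) = head 1 r.
  by have [j {3}->] := trimP r; case: (trim r).
move=> neR neL; rewrite !head_trim //.
by apply/is_gcdL1 => //; apply/simple_pos/normal_head.
Qed.

(** The default value 1 makes the coprimeness of the first entries hold also when
    one of the sequences is empty. *)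
Lemma product_snf z T S : symmetric_normal_form z T S ->
  [/\ normal T, normal S, coprimeL (head 1 S) (head 1 T) &
    z = (\prod_(x <- T) x)^-1 * (\prod_(x <- S) x)].
Proof.
case=> zE norT norS _ gcd; split=> //; last by rewrite -prodV_rev.
case: S T norT norS gcd {zE} => [|s S] T norT norS gcd.
  exact/coprimeL_sym/coprimeL1.
case: T norT gcd => [|t T] norT gcd; first exact: coprimeL1.
by apply/is_gcdL1; [exact/simple_pos/(normal_head norS) |
  exact/simple_pos/(normal_head norT) | exact: gcd].
Qed.

Lemma head_tau r : head 1 [seq tau x | x <- r] = tau (head 1 r).
Proof. by case: r => //=; rewrite /tau conj1g. Qed.

Lemma rstar_tau s : rstar (tau s) = tau (rstar s).
Proof.
have tauM : tau (s^-1 * D) = (tau s)^-1 * tau D by rewrite /tau conjMg conjVg.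
by rewrite /rstar tauM tau_Delta.
Qed.

Lemma normal_tau r : normal [seq tau x | x <- r] -> normal r.
Proof.
elim: r => // s r IH; rewrite map_cons => /normal_cons[/simple_tau ss /IH norr].
by rewrite rstar_tau head_tau => /coprimeL_tau cp; apply/normal_cons.
Qed.

Lemma prod_tau r : \prod_(x <- [seq tau x | x <- r]) x = tau (\prod_(x <- r) x).
Proof. by rewrite big_map /tau conjg_prod. Qed.

(** Multiplying by u is dividing by lstar u, then multiplying by Delta.  The
    factor Delta moves to the left through y, which undoes tau, and makes v^-1
    into rstar v. *)
Lemma mul_lstar z u v x y : z * (lstar u)^-1 = (v * x)^-1 * tau y ->
  z * u = x^-1 * (rstar v * y).
Proof.
have genE d : z * (d * u^-1)^-1 = (v * x)^-1 * y ^ d^-1 ->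
    z * u = x^-1 * (v^-1 * d * y).
  move=> zE; have -> : z * u = z * (d * u^-1)^-1 * d.
    by rewrite invMg invgK -!mulgA mulVg mulg1.
  by rewrite zE conjgE invgK invMg -!mulgA mulVg mulg1.
exact: genE.
Qed.

End Pass.

Theorem proposition2p17 (n : nat) (n_ge2 : (2 <= n)%N)
    (z u : braid n) (t s : seq (braid n))
    (snf_z : symmetric_normal_form z t s) (simple_u : simple u) :
  (* (i) *)
  (forall (u_ s'_ v_ t'_ : nat -> braid n),
     let p := size s in
     let t1 := if t is [::] then [:: 1] else t in
     let q := size t1 in
     u_ p = u ->
     (forall i : nat, (1 <= i <= p)%N ->
        (u_ i.-1, s'_ i) = normal_pair (nth 1 s i.-1 * u_ i)) ->
     (v_ 0%N, v_ 1%N) = normal_pair (lstar (u_ 0%N) * nth 1 t1 0) ->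
     (forall j : nat, (2 <= j <= q)%N ->
        (t'_ j, v_ j) = normal_pair (v_ j.-1 * nth 1 t1 j.-1)) ->
     symmetric_normal_form (z * u)
       (trim (rcons [seq t'_ j | j <- iota 2 q.-1] (v_ q)))
       (trim (rstar (v_ 0%N) :: [seq s'_ i | i <- iota 1 p])))
  /\
  (* (ii) *)
  (forall (u_ s'_ v_ t'_ : nat -> braid n),
     let p := size s in
     let q := size t in
     u_ p = u ->
     (forall i : nat, (1 <= i <= p)%N ->
        (s'_ i, u_ i.-1) = coprime_pair (nth 1 s i.-1) (u_ i)) ->
     v_ 0%N = u_ 0%N ->
     (forall j : nat, (1 <= j <= q)%N ->
        (t'_ j, v_ j) = normal_pair (v_ j.-1 * nth 1 t j.-1)) ->
     symmetric_normal_form (z * u^-1)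
       (trim (rcons [seq t'_ j | j <- iota 1 q] (v_ q)))
       (trim [seq s'_ i | i <- iota 1 p])).
Proof.
case: n n_ge2 z u t s snf_z simple_u => [//|m] _ z u t s /product_snf[nort nors cp zE] su.
have simnth (r : seq (braid m.+1)) k : normal r -> simple (nth 1 r k).
  case=> sim _; have [kr|rk] := ltnP k (size r); first exact/sim/mem_nth.
  by rewrite nth_default //; exact: simple1.
split=> [u_ s'_ v_ t'_ p t1 q uE us v01 tv | u_ s'_ v_ t'_ p q uE us v0 tv].
  have nort1 : normal t1.
    rewrite /t1; case: (t) nort => // _.
    by apply/normal_cons; split; [exact: simple1 | exact: normal_nil | exact: coprimeL1].
  have cp1 : coprimeL (head 1 s) (head 1 t1) by move: cp; rewrite /t1; case: (t).
  have t1E : \prod_(x <- t1) x = \prod_(x <- t) x.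
    by rewrite /t1; case: (t) => //; rewrite big_seq1 big_nil.
  have simu k : (k <= p)%N -> simple (u_ (p - k)%N).
    elim: k => [|k IH] kp; first by rewrite subn0 uE.
    have /us : (1 <= p - k <= p)%N by lia.
    rewrite -subnS => /normal_pairP[] //; [exact: simnth | exact/IH/ltnW].
  have {}simu k : (k <= p)%N -> simple (u_ k) by move/subKn=> <-; exact: simu (leq_subr _ _).
  have stepu j : (j < p)%N -> [/\ simple (s'_ j.+1), nth 1 s j * u_ j.+1 = u_ j * s'_ j.+1 &
      coprimeL (rstar (u_ j)) (s'_ j.+1)].
    by move=> jp; have [||] := normal_pairP _ _ (us j.+1 jp); [exact: simnth|exact: simu|].
  (* Part (i) as a division by lstar u: its squares for the numerators are
     lstar u_(i-1) * s_i = tau s'_i * lstar u_i, and v_0 is the first of the new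
     denominators. *)
  pose V j := if j is 0%N then lstar (u_ 0%N) else v_ j.
  pose V' j := if j is 0%N then v_ 0%N else t'_ j.+1.
  have tv' j : (j < q)%N -> (V' j, V j.+1) = normal_pair (V j * nth 1 t1 j).
    by case: j => [|j] jq; [exact: v01 | exact: (tv j.+2)].
  have simV j : (j <= q)%N -> simple (V j).
    elim: j => [|j IH] jq; first exact/simple_lstar/simu.
    by have [] := normal_pairP (IH (ltnW jq)) (simnth t1 j nort1) (tv' j jq).
  have [||j jp|j jq|] := @quotient_pass m s t1 (fun j => lstar (u_ j)) V
    (fun j => tau (s'_ j.+1)) V' nors nort1 cp1 erefl.
  - by move=> j jp; exact/simple_lstar/simu.
  - by [].
  - have [ss eqs cps] := stepu j jp; split; first exact/simple_tau.
      have genE d : d * (u_ j)^-1 * nth 1 s j = s'_ j.+1 ^ d^-1 * (d * (u_ j.+1)^-1).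
        rewrite conjgE invgK -!mulgA mulKg; congr (_ * _); apply: (mulgI (u_ j)).
        by rewrite mulKVg mulgA -eqs mulgK.
      exact: genE.
    by rewrite /= lstarE; apply/coprimeL_tau/coprimeL_sym.
  - by have [] := normal_pairP (simV j (ltnW jq)) (simnth t1 j nort1) (tv' j jq).
  set R := [seq s'_ i | i <- iota 1 p].
  have -> : mkseq (fun j => tau (s'_ j.+1)) (size s) = [seq tau x | x <- R].
    by rewrite /R (iotaDl 1 0) -!map_comp.
  set L := rcons [seq t'_ j | j <- iota 2 q.-1] (v_ q).
  have -> : rcons (mkseq V' (size t1)) (V (size t1)) = v_ 0%N :: L.
    have q0 : (0 < q)%N by rewrite /q /t1; case: (t).
    rewrite /L -/q -(prednK q0) mkseqS rcons_cons; congr (_ :: rcons _ _).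
    by rewrite (iotaDl 2 0) -map_comp.
  move=> /normal_cons[sv0 norL cpL] /normal_tau norR.
  rewrite head_tau /= => cpRL zuE; apply: snf_trim => //.
  - apply/normal_cons; split=> //; first exact: simple_rstar.
    by apply/coprimeL_tau; rewrite tau_rstar_rstar; exact: coprimeL_sym.
  - rewrite big_cons; apply: mul_lstar.
    by move: zuE; rewrite t1E -zE prod_tau big_cons -/p uE.
have simu k : (k <= p)%N -> simple (u_ (p - k)%N).
  elim: k => [|k IH] kp; first by rewrite subn0 uE.
  have /us : (1 <= p - k <= p)%N by lia.
  rewrite -subnS => /coprime_pairP[] //; [exact: simnth | exact/IH/ltnW].
have {}simu k : (k <= p)%N -> simple (u_ k) by move/subKn=> <-; exact: simu (leq_subr _ _).
have stepu j : (j < p)%N -> [/\ simple (s'_ j.+1), u_ j * nth 1 s j = s'_ j.+1 * u_ j.+1 &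
    coprimeL (s'_ j.+1) (u_ j)].
  move=> jp; have [||sj _ eqs cps] := coprime_pairP _ _ (us j.+1 jp); last by split.
    exact: simnth.
  exact: simu.
have simv j : (j <= q)%N -> simple (v_ j).
  elim: j => [|j IH] jq; first by rewrite v0; exact: simu.
  by have [] := normal_pairP (IH (ltnW jq)) (simnth t j nort) (tv j.+1 jq).
have [j jq|] := @quotient_pass m s t u_ v_ (fun j => s'_ j.+1) (fun j => t'_ j.+1)
  nors nort cp v0 simu simv stepu.
  by have [] := normal_pairP (simv j (ltnW jq)) (simnth t j nort) (tv j.+1 jq).
rewrite /mkseq !(map_comp _ succn) -!(iotaDl 1 0) => norL norR cpLR prodE.
by apply: snf_trim => //; rewrite zE -uE; exact: prodE.
Qed.
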